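(* For $\delta_2u_1\le\delta_1u_2$, the pair $(\psi(u_1,u_2,s),\phi(u_1,u_2,s))^{\top}$ solves the Feynman–Kac system $$\begin{pmatrix}c_1&0\\0&-\delta_1\end{pmatrix}\begin{pmatrix}\psi_{u_1}\\ \phi_{u_1}\end{pmatrix}+\begin{pmatrix}c_2&0\\0&-\delta_2\end{pmatrix}\begin{pmatrix}\psi_{u_2}\\ \phi_{u_2}\end{pmatrix}+\begin{pmatrix}-\lambda-s&\lambda\\ \mu&-\mu\end{pmatrix}\begin{pmatrix}\psi\\ \phi\end{pmatrix}=\begin{pmatrix}0\\0\end{pmatrix},$$ where subscripts $u_i$ denote partial derivatives with respect to $u_i$, with the boundary conditions $$\psi\Big(u_1,\tfrac{\delta_2}{\delta_1}u_1,s\Big)=C_2\,e^{-\gamma_2u_1/\delta_1}\quad\text{for all }u_1\ge 0,\qquad \phi(0,u_2,s)=1\quad\text{for all }u_2\ge 0.$$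
   Context: Parameters: $\delta_1,\delta_2>0$ with $\delta_1+\delta_2=1$; premium rates $c_1,c_2>0$; $p_i=c_i/\delta_i$ with $p_1>p_2$; $\lambda,\mu>0$; $\rho=\lambda/\mu$; and $p_i>\rho$ for $i=1,2$. Let $S(t)=\sum_{k=1}^{N(t)}\sigma_k$, where $N$ is a Poisson process of intensity $\lambda$ and the $\sigma_k$ are i.i.d. exponential random variables with parameter $\mu$ (mean $\mu^{-1}$), independent of $N$. For initial reserves $u_1,u_2\ge 0$ set $U_i(t)=u_i+c_it-\delta_iS(t)$, $i=1,2$, and, for $s\ge0$, $$\tau(u_1,u_2)=\inf\{t\ge 0: U_1(t)<0\text{ or }U_2(t)<0\},\qquad \psi(u_1,u_2,s)=E\big[e^{-s\tau(u_1,u_2)}\mathbf 1_{\{\tau(u_1,u_2)<\infty\}}\big].$$ Constants: $\gamma_2=\mu-\lambda/p_2$ and $C_2=\lambda/(\mu p_2)$. Fluid embedding: let $\tau_1,\tau_2,\dots$ be i.i.d. exponential($\lambda$) (the inter-arrival times) and $\sigma_1,\sigma_2,\dots$ i.i.d. exponential($\mu$) (the claim sizes), all independent. Put $S_0=0$ and for $n\ge1$: if $Y_0=1$, $S_{2n-1}=S_{2n-2}+\tau_n$, $S_{2n}=S_{2n-1}+\sigma_n$; if $Y_0=-1$, $S_{2n-1}=S_{2n-2}+\sigma_n$, $S_{2n}=S_{2n-1}+\tau_n$. The $\{-1,+1\}$-valued process $Y$ starts at $Y_0$, is constant on each $[S_{n-1},S_n)$, and switches sign at each $S_n$, $n\ge1$.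 Let $I(t)=\int_0^t\mathbf 1_{\{Y_v=1\}}\,dv$, $\tilde U_i(t)=u_i+c_iI(t)-\delta_i(t-I(t))$ for $i=1,2$, and $\tilde\tau(u_1,u_2)=\inf\{t\ge 0:\min\{\tilde U_1(t),\tilde U_2(t)\}<0\}$. Then $$\phi(u_1,u_2,s)=E\big[e^{-sI(\tilde\tau(u_1,u_2))}\mathbf 1_{\{\tilde\tau(u_1,u_2)<\infty\}}\,\big|\,Y_0=-1\big].$$
   Formalization: The diagonal condition with the printed C_2, γ_2 fails for s>0; it is proved for s=0, and for all s≥0 with s-dependent constants. Partial derivatives are relative to the region δ_2u_1≤δ_1u_2 (one-sided on its boundary); the system is not claimed at (0,0), where the u_1-derivative is undefined. *)

(* Defs.v *)
From HB Require Import structures.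
From mathcomp Require Import all_boot all_order all_algebra finmap.
From mathcomp Require Import all_classical all_reals all_analysis.

Set Implicit Arguments.
Unset Strict Implicit.
Unset Printing Implicit Defensive.

Import Order.TTheory GRing.Theory Num.Theory.
Import numFieldNormedType.Exports.

Local Open Scope classical_set_scope.
Local Open Scope ring_scope.

(* Sequences are indexed from 0: [tau k] and [sigma k] stand for tau_{k+1} and
   sigma_{k+1}. *)

Section Probability.
Context (d : measure_display) (T : measurableType d) (R : realType)
  (P : probability T R).

Definition mutually_independent (I : eqType) (X : I -> {RV P >-> R}) : Prop :=
  forall (J : seq I) (B : I -> set R), uniq J ->
    (forall i, measurable (B i)) ->
    P (\bigcap_(i in [set` J]) (X i @^-1` B i)) =
    (\prod_(i <- J) P (X i @^-1` B i))%E.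

Definition has_exponential_law (rate : R) (X : {RV P >-> R}) : Prop :=
  forall B : set R, measurable B -> distribution P X B = exponential_prob rate B.

Definition source_family (Y0 : {RV P >-> R}) (tau sigma : nat -> {RV P >-> R})
    (i : option (nat + nat)) : {RV P >-> R} :=
  match i with
  | None => Y0
  | Some (inl k) => tau k
  | Some (inr k) => sigma k
  end.

(* E[X | A] for an event A of positive probability *)
Definition conditional_expectation (X : T -> R) (A : set T) : R :=
  fine ('E_P[(fun w => X w * \1_A w)]) / fine (P A).

End Probability.

Section Paths.
Context (R : realType).

Definition partial_sum (x : nat -> R) (n : nat) : R := \sum_(k < n) x k.

(* Number of n >= 1 with e n <= t.  The cardinal is 0 when there are infinitely
   many, which happens with probability 0 for the epochs considered below. *)
Definition count_epochs (e : nat -> R) (t : R) : nat :=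
  #|` fset_set [set n : nat | (0 < n)%N /\ e n <= t] |.

Definition hitting_time (A : set R) : \bar R :=
  ereal_inf [set t%:E | t in [set t : R | 0 <= t /\ A t]].

(* N(t): the Poisson process whose inter-arrival times are the [tau k] *)
Definition claim_count (tau : nat -> R) (t : R) : nat :=
  count_epochs (partial_sum tau) t.

Definition aggregate_claims (tau sigma : nat -> R) (t : R) : R :=
  \sum_(k < claim_count tau t) sigma k.

Definition reserve (tau sigma : nat -> R) (c delta u t : R) : R :=
  u + c * t - delta * aggregate_claims tau sigma t.

Definition ruin_time (tau sigma : nat -> R) (c1 c2 delta1 delta2 u1 u2 : R)
    : \bar R :=
  hitting_time [set t | reserve tau sigma c1 delta1 u1 t < 0 \/
                        reserve tau sigma c2 delta2 u2 t < 0].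

(* Length S_{k+1} - S_k of the k-th period of the fluid embedding *)
Definition fluid_period (y0 : R) (tau sigma : nat -> R) (k : nat) : R :=
  if (y0 == 1) (+) odd k then tau k./2 else sigma k./2.

Definition fluid_epoch (y0 : R) (tau sigma : nat -> R) : nat -> R :=
  partial_sum (fluid_period y0 tau sigma).

Definition fluid_sign (y0 : R) (tau sigma : nat -> R) (t : R) : R :=
  y0 * (-1) ^+ count_epochs (fluid_epoch y0 tau sigma) t.

Definition up_time (y0 : R) (tau sigma : nat -> R) (t : R) : R :=
  \int[lebesgue_measure]_(v in `[0, t])
    \1_[set v | fluid_sign y0 tau sigma v = 1] v.

Definition fluid_reserve (y0 : R) (tau sigma : nat -> R) (c delta u t : R) : R :=
  u + c * up_time y0 tau sigma t - delta * (t - up_time y0 tau sigma t).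

Definition fluid_ruin_time (y0 : R) (tau sigma : nat -> R)
    (c1 c2 delta1 delta2 u1 u2 : R) : \bar R :=
  hitting_time [set t | Num.min (fluid_reserve y0 tau sigma c1 delta1 u1 t)
                                (fluid_reserve y0 tau sigma c2 delta2 u2 t) < 0].

End Paths.

Section RuinTransforms.
Context (d : measure_display) (T : measurableType d) (R : realType)
  (P : probability T R).
Variables (Y0 : {RV P >-> R}) (tau sigma : nat -> {RV P >-> R})
  (c1 c2 delta1 delta2 : R).

Definition psi (u1 u2 s : R) : R :=
  let rt w := ruin_time (tau ^~ w) (sigma ^~ w) c1 c2 delta1 delta2 u1 u2 in
  fine ('E_P[(fun w => expR (- s * fine (rt w)) *
                       \1_[set w | (rt w < +oo)%E] w)]).

Definition phi (u1 u2 s : R) : R :=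
  let rt w := fluid_ruin_time (Y0 w) (tau ^~ w) (sigma ^~ w)
                c1 c2 delta1 delta2 u1 u2 in
  conditional_expectation P
    (fun w => expR (- s * up_time (Y0 w) (tau ^~ w) (sigma ^~ w) (fine (rt w))) *
              \1_[set w | (rt w < +oo)%E] w)
    [set w | Y0 w = -1].

End RuinTransforms.

Section Cone.
Context (R : realType).

Definition upper_cone (delta1 delta2 : R) : set (R * R) :=
  [set u | [/\ 0 <= u.1, 0 <= u.2 & delta2 * u.1 <= delta1 * u.2]].

(* Derivative of f at x relative to A: the two-sided derivative when x is
   interior to A, a one-sided one when x is an endpoint of A.  It is only
   meaningful when x is not isolated in A. *)
Definition has_derivative_within (A : set R) (f : R -> R) (x l : R) : Prop :=
  h^-1 * (f (x + h) - f x) @[h --> within [set h | A (x + h)] 0^'] --> l.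

Definition has_partials_within (D : set (R * R)) (f : R -> R -> R)
    (u1 u2 f1 f2 : R) : Prop :=
  has_derivative_within [set x | D (x, u2)] (f ^~ u2) u1 f1 /\
  has_derivative_within [set y | D (u1, y)] (f u1) u2 f2.

(* Nonnegative root of p g^2 + (lam + s - mu p) g - s mu = 0, the decay rate of
   the discounted one-dimensional ruin transform E[exp(- s tau); tau < oo] of
   x + p t - S(t); it equals mu - lam / p at s = 0. *)
Definition adjustment_rate (lam mu p s : R) : R :=
  (mu * p - lam - s + Num.sqrt ((mu * p - lam - s) ^+ 2 + 4 * p * s * mu))
    / (2 * p).

(* Value at x = 0 of the same transform; it equals lam / (mu p) at s = 0. *)
Definition adjustment_coef (lam mu p s : R) : R :=
  1 - adjustment_rate lam mu p s / mu.

End Cone.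

(* Main.v *)
(* Put x_i = u_i / delta_i, x = x_1 and th = (x_2 - x_1) / (p_1 - p_2), the time at
   which the lines x_1 + p_1 t and x_2 + p_2 t cross.  In the coordinates (x, th)
   the system reads
     phi_x = mu (psi - phi),   psi_th = p_1 psi_x - (lam + s) psi + lam phi,
   with phi(0, th) = 1 and the one-dimensional ruin transform at th = 0.  It is
   solved by an entire double power series times e^{- mu x}, whose coefficients
   obey a linear recursion and a geometric bound; the solution is O(e^{- g x})
   for th in a bounded interval, where g is the adjustment rate.

   Integrating the system along a climb of exponential(lam) length or a drop of
   exponential(mu) length shows that the discounted solution, evaluated along the
   process stopped at ruin and observed at its turning points, has constant mean.
   Letting the number of half steps grow, the solvent paths contribute nothing in
   the limit and the ruined ones contribute e^{- s t}, with t the elapsed time at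
   ruin.  Hence psi and phi are the two components of the solution on the cone,
   and their differentiability, the system and the boundary values are those of
   the series. *)

Require Import Defs.
From HB Require Import structures.
From mathcomp Require Import all_boot all_order all_algebra finmap.
From mathcomp Require Import all_classical all_reals all_analysis.
From mathcomp Require Import measurable_realfun random_variable ring lra.

Set Implicit Arguments.
Unset Strict Implicit.
Unset Printing Implicit Defensive.

Import Order.TTheory GRing.Theory Num.Theory.
Import numFieldNormedType.Exports.

Local Open Scope classical_set_scope.
Local Open Scope ring_scope.

(** Differentiability of the transforms is hard to extract from their definition as expectations, so
    it is never sought there: a smooth candidate is built first and then matched with them on the
    cone. Division by [delta_i] makes both companies pay the same claims, so that ruin means
    crossing the lower of two lines. After the two lines meet only the second one matters, whence
    one-dimensional data with slope [p2] at th = 0.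

    The candidate is not known to be nonnegative before it is matched, so its constant mean is
    proved after adding a constant bound, and Tonelli suffices. The decay on solvent paths comes
    from the equation of g, which reads (lam + s + g p2)(mu - g) = lam mu: the weight e^{-g level}
    is exactly kept in mean by a climb and a drop on one line of slope [p2], and halving g makes
    that factor smaller than 1. The ruin functionals are not shown measurable; they are limits of
    chain payoffs off a null set, which determines their integrals.

    The value on the diagonal involves the root g at the given s; [gamma2] and [C2] are what it
    becomes at s = 0. *)

Ltac positivity := repeat first
  [ by [] | exact: expR_ge0 | exact: expR_gt0 | exact: sqr_ge0 | exact: normr_ge0
  | by apply: ltW | apply: exprn_gt0 | apply: exprn_ge0
  | apply: addr_gt0 | apply: divr_gt0 | apply: mulr_gt0
  | apply: addr_ge0 | apply: divr_ge0 | apply: mulr_ge0 ].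

(** * Double power series *)

Section ExponentialGeneratingSeries.
Context {R : realType}.
Implicit Types (a b : nat -> R) (x y h M K L : R).

(** With the weights x^k / k!, differentiation is the shift of coefficients, so the differential
    system becomes a recursion without factors k, and a geometric bound on a makes the sum
    entire. *)
Definition egs a x : R := limn (series (fun k => a k * exp_coeff x k)).

Definition geometric_bound a M K := forall k, `|a k| <= M * K ^+ k.

Lemma geometric_bound_ge0 a M K : geometric_bound a M K -> 0 <= M.
Proof. by move=> aM; have := le_trans (normr_ge0 _) (aM 0%N); rewrite expr0 mulr1. Qed.

Lemma exp_coeffS x k : k.+1%:R * exp_coeff x k.+1 = x * exp_coeff x k.
Proof.
rewrite /exp_coeff /= factS exprS natrM.
have k1 : (k.+1%:R : R) != 0 by rewrite pnatr_eq0.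
have kf : (k`!%:R : R) != 0 by rewrite pnatr_eq0 -lt0n fact_gt0.
by rewrite invfM mulrCA mulVKf // mulrA.
Qed.

Lemma exp_coeff0 x : exp_coeff x 0 = 1.
Proof. by rewrite /exp_coeff /= expr0 fact0 divr1. Qed.

Lemma exp_coeff1 x : exp_coeff x 1 = x.
Proof. by rewrite -[LHS]mul1r (exp_coeffS x 0) exp_coeff0 mulr1. Qed.

Lemma norm_exp_coeff x k : `|exp_coeff x k| = exp_coeff `|x| k.
Proof.
by rewrite /exp_coeff /= normrM normrX normfV (ger0_norm (ler0n _ _)).
Qed.

Lemma exp_coeff_le x y k : 0 <= x -> x <= y -> exp_coeff x k <= exp_coeff y k.
Proof.
by move=> x0 xy; rewrite /exp_coeff /= ler_wpM2r ?invr_ge0 ?ler0n // lerXn2r ?nnegrE // (le_trans x0).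
Qed.

Lemma exp_coeffZ K x k : exp_coeff (K * x) k = K ^+ k * exp_coeff x k.
Proof. by rewrite /exp_coeff /= exprMn mulrA. Qed.

Lemma series_exp_coeff_le x n : 0 <= x -> series (exp_coeff x) n <= expR x.
Proof.
move=> x0; apply: nondecreasing_cvgn_le; last exact: is_cvg_series_exp_coeff.
apply/nondecreasing_seqP => k; rewrite !seriesEnat /= big_nat_recr //= lerDl.
exact: exp_coeff_ge0.
Qed.

Lemma cvg_egs a M K x : 0 <= K -> geometric_bound a M K ->
  series (fun k => a k * exp_coeff x k) @ \oo --> egs a x.
Proof.
move=> K0 aM; apply: normed_cvg.
have M0 := geometric_bound_ge0 aM.
apply: (@series_le_cvg _ _ (M *: exp_coeff (K * `|x|))) => [k|k|k|].
- exact: normr_ge0.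
- by rewrite /= mulr_ge0 // exp_coeff_ge0 // mulr_ge0.
- rewrite /= normrM norm_exp_coeff [X in _ <= X](_ : _ = M * exp_coeff (K * `|x|) k) //.
  by rewrite exp_coeffZ mulrA ler_wpM2r // exp_coeff_ge0.
- by apply: is_cvg_seriesZ; exact: is_cvg_series_exp_coeff.
Qed.

Arguments cvg_egs {a M K x}.

Lemma egs_le a M K x : 0 <= K -> geometric_bound a M K ->
  `|egs a x| <= M * expR (K * `|x|).
Proof.
move=> K0 aM.
have M0 := geometric_bound_ge0 aM.
apply: (@closed_cvg _ _ _ eventually_filter (fun n => `|series (fun k => a k * exp_coeff x k) n|)
  (fun z => z <= M * expR (K * `|x|))).
- exact: closed_le.
- apply: nearW => n; rewrite seriesEnat /=.
  apply: le_trans (ler_norm_sum _ _ _) _.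
  apply: (@le_trans _ _ (M * series (exp_coeff (K * `|x|)) n)).
    rewrite seriesEnat /= mulr_sumr; apply: ler_sum => k _.
    by rewrite normrM norm_exp_coeff exp_coeffZ mulrA ler_wpM2r // exp_coeff_ge0.
  by rewrite ler_wpM2l // series_exp_coeff_le // mulr_ge0.
- by apply: cvg_norm; exact: cvg_egs aM.
Qed.

Lemma egs_lin a b M N K c x : 0 <= K -> geometric_bound a M K ->
  geometric_bound b N K -> egs (fun k => c * a k + b k) x = c * egs a x + egs b x.
Proof.
move=> K0 aM bN; apply/cvg_lim => //.
rewrite (_ : series _ = c *: series (fun k => a k * exp_coeff x k) + series (fun k => b k * exp_coeff x k)).
  by apply: cvgD; [apply: cvgZr; exact: cvg_egs aM|exact: cvg_egs bN].
apply/funext => n; rewrite seriesEnat /= fctE !seriesEnat /= [(_ *: _) n](_ : _ = c * \sum_(0 <= k < n) a k * exp_coeff x k); last by [].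
rewrite mulr_sumr -big_split /=; apply: eq_bigr => k _; ring.
Qed.

Let taylor2 x h k := exp_coeff (x + h) k.+1 - exp_coeff x k.+1 - h * exp_coeff x k.

(** The recursion (k+1) e_{k+1} = x e_k of the monomials e_k = x^k / k! passes to their second-order
    remainders with the extra source h^2 e_k; induction on that recursion gives the bound. *)
Lemma exp_coeff_taylor2 x h k :
  `|taylor2 x h k.+1| <= h ^+ 2 * exp_coeff (`|x| + `|h|) k.
Proof.
set r := `|x| + `|h|.
have r0 : 0 <= r by rewrite addr_ge0.
have step j : j.+2%:R * taylor2 x h j.+1 = (x + h) * taylor2 x h j + h ^+ 2 * exp_coeff x j.
  rewrite /taylor2 mulrBr mulrBr !exp_coeffS.
  have -> : j.+2%:R * (h * exp_coeff x j.+1) = h * (x * exp_coeff x j) + h * exp_coeff x j.+1.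
    by rewrite -exp_coeffS -natr1; ring.
  by ring.
have t0 : taylor2 x h 0 = 0.
  by rewrite /taylor2 !exp_coeff1 exp_coeff0; ring.
elim: k => [|k IH].
  have /(congr1 (fun z => z / 2%:R)) := step 0%N.
  rewrite mulrC mulKr ?unitfE // t0 mulr0 add0r => ->.
  rewrite normrM !exp_coeff0 !mulr1 ger0_norm ?sqr_ge0 //.
  by rewrite ger0_norm ?invr_ge0 // ler_piMr ?sqr_ge0 // invf_le1 ?ltr0n // ler1n.
have k0 : 0 < (k.+3%:R : R) by rewrite ltr0n.
rewrite -(ler_pM2l k0) -[X in X * _](ger0_norm (ltW k0)) -normrM step.
apply: le_trans (ler_normD _ _) _.
(* Of the k+3 copies, k+1 absorb the induction term by [exp_coeffS], and the other two absorb the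
   source. *)
have -> : k.+3%:R * (h ^+ 2 * exp_coeff r k.+1) = h ^+ 2 * (k.+1%:R * exp_coeff r k.+1) + h ^+ 2 * exp_coeff r k.+1 *+ 2.
  by rewrite -[k.+3]addn2 natrD; ring.
rewrite exp_coeffS; apply: lerD.
  rewrite normrM mulrCA ler_pM //; exact: ler_normD.
rewrite normrM normrX real_normK ?num_real // norm_exp_coeff -mulrnAr ler_wpM2l ?sqr_ge0 //.
apply: (@le_trans _ _ (exp_coeff r k.+1)); first by rewrite exp_coeff_le // lerDl.
by rewrite mulr2n lerDl exp_coeff_ge0.
Qed.

(** An explicit remainder, linear in M, replaces termwise differentiation: it can be applied to
    every inner series of a double series and summed again. *)
Lemma egs_taylor2 a M K x h : 0 <= K -> geometric_bound a M K ->
  `|egs a (x + h) - egs a x - h * egs (fun k => a k.+1) x| <=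
    M * K ^+ 2 * h ^+ 2 * expR (K * (`|x| + `|h|)).
Proof.
move=> K0 aM.
have M0 := geometric_bound_ge0 aM.
have aMS : geometric_bound (fun k => a k.+1) (M * K) K.
  by move=> k; rewrite -mulrA -exprS; exact: aM.
pose sr a x := series (fun k => a k * exp_coeff x k).
(* The shifted series is cut one term earlier, so that u n is exactly a sum of Taylor remainders.
   Its term of index 0 comes from a linear monomial and vanishes, which leaves the factor K^2. *)
pose u n := sr a (x + h) n.+1 - sr a x n.+1 - h * sr (fun k => a k.+1) x n.
apply: (@closed_cvg _ _ _ eventually_filter (fun n => `|u n|)
  (fun z => z <= M * K ^+ 2 * h ^+ 2 * expR (K * (`|x| + `|h|)))).
- exact: closed_le.
- apply: nearW => n.
  have -> : u n = \sum_(0 <= k < n) a k.+1 * taylor2 x h k.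
    rewrite /u /sr !seriesEnat /= !big_nat_recl //= mulr_sumr.
    rewrite !exp_coeff0 opprD addrACA subrr add0r -!sumrB.
    by apply: eq_bigr => k _; rewrite /taylor2; ring.
  apply: le_trans (ler_norm_sum _ _ _) _.
  case: n => [|n].
    rewrite big_geq //.
    by rewrite mulr_ge0 ?expR_ge0 // mulr_ge0 ?sqr_ge0 // mulr_ge0 ?sqr_ge0.
  rewrite big_nat_recl //= [X in X + _](_ : _ = 0) ?add0r; last first.
    by rewrite /taylor2 !exp_coeff1 exp_coeff0 (_ : x + h - x - h * 1 = 0) ?mulr0 ?normr0 //; ring.
  apply: (@le_trans _ _ (M * K ^+ 2 * h ^+ 2 * series (exp_coeff (K * (`|x| + `|h|))) n)).
    rewrite seriesEnat /= mulr_sumr; apply: ler_sum => k _.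
    rewrite normrM exp_coeffZ.
    apply: le_trans (ler_pM (normr_ge0 _) (normr_ge0 _) (aM _) (exp_coeff_taylor2 _ _ _)) _.
    rewrite !exprS le_eqVlt; apply/orP; left; apply/eqP. ring.
  apply: ler_wpM2l; last by apply: series_exp_coeff_le; rewrite mulr_ge0 ?addr_ge0.
  by rewrite mulr_ge0 ?sqr_ge0 // mulr_ge0 ?sqr_ge0.
- apply: cvg_norm; apply: cvgB; first apply: cvgB.
  + by rewrite (cvg_shiftS (sr a (x + h))); exact: cvg_egs aM.
  + by rewrite (cvg_shiftS (sr a x)); exact: cvg_egs aM.
  + by apply: cvgMr; exact: cvg_egs aMS.
Qed.

End ExponentialGeneratingSeries.

Section DoubleSeries.
Context {R : realType}.
Implicit Types (b : nat -> nat -> R) (f : R -> R) (x y h M K L : R).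

(** The first index of b goes with y, the second with x. As an iterated sum it is handled by two
    uses of the one-variable lemmas. *)
Definition degs b x y : R := egs (fun k => egs (b ^~ k) y) x.

Definition geometric_bound2 b M L K :=
  forall n k, `|b n k| <= M * L ^+ n * K ^+ k.

Lemma quadratic_is_derive f x l M :
  (forall h, `|h| <= 1 -> `|f (x + h) - f x - h * l| <= M * h ^+ 2) ->
  is_derive x 1 f l.
Proof.
move=> fM.
have M0 : 0 <= M.
  by have := le_trans (normr_ge0 _) (fM 1 _); rewrite expr1n mulr1; apply; rewrite normr1.
have cv : h^-1 *: (f (h *: 1 + x) - f x) @[h --> 0^'] --> l.
  apply/cvgrPdist_le => e e0; near=> h.
  have h0 : h != 0 by near: h; exact: nbhs_dnbhs_neq.
  have h1 : `|h| <= 1 by near: h; apply: dnbhs0_le.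
  have hM : `|h| <= e / (M + 1) by near: h; apply: dnbhs0_le; rewrite divr_gt0 // ltr_wpDl.
  rewrite -normrN opprB scaler1 addrC.
  have hp : 0 < `|h| by rewrite normr_gt0.
  rewrite -(ler_pM2l hp) -normrM [h + x]addrC [_ *: _]/(_ * _).
  rewrite mulrDr mulrA mulfV // mul1r addrC mulrN.
  rewrite [- _ + _]addrC [h + x]addrC; apply: le_trans (fM _ h1) _.
  rewrite -real_normK ?num_real // expr2 mulrCA ler_pM2l //.
  apply: (@le_trans _ _ ((M + 1) * `|h|)); first by rewrite ler_wpM2r // lerDl.
  by rewrite mulrC -ler_pdivlMr // ltr_wpDl.
by apply: DeriveDef; [apply/cvg_ex; exists l|apply/cvg_lim].
Unshelve. all: by end_near. Qed.

Section Bounded.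
Variables (b : nat -> nat -> R) (M L K : R).
Hypotheses (L0 : 0 <= L) (K0 : 0 <= K) (bM : geometric_bound2 b M L K).

Lemma geometric_bound2_ge0 : 0 <= M.
Proof. by have := le_trans (normr_ge0 _) (bM 0 0); rewrite !expr0 !mulr1. Qed.

Lemma geometric_bound_row k : geometric_bound (b ^~ k) (M * K ^+ k) L.
Proof. by move=> n; rewrite mulrAC; exact: bM. Qed.

Lemma geometric_bound_egs y :
  geometric_bound (fun k => egs (b ^~ k) y) (M * expR (L * `|y|)) K.
Proof. by move=> k; rewrite mulrAC; apply: egs_le => //; exact: geometric_bound_row. Qed.

Lemma geometric_bound2_shiftx : geometric_bound2 (fun n k => b n k.+1) (M * K) L K.
Proof.
move=> n k; apply: le_trans (bM _ _) _.
by rewrite exprS le_eqVlt; apply/orP; left; apply/eqP; ring.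
Qed.

Lemma geometric_bound2_shifty : geometric_bound2 (fun n k => b n.+1 k) (M * L) L K.
Proof. by move=> n k; apply: le_trans (bM _ _) _; rewrite exprS mulrA. Qed.

Lemma degs_le x y : `|degs b x y| <= M * expR (L * `|y|) * expR (K * `|x|).
Proof. by apply: egs_le => //; exact: geometric_bound_egs. Qed.

Lemma degs_taylorx x y h :
  `|degs b (x + h) y - degs b x y - h * degs (fun n k => b n k.+1) x y| <=
    M * expR (L * `|y|) * K ^+ 2 * h ^+ 2 * expR (K * (`|x| + `|h|)).
Proof. by apply: egs_taylor2 => //; exact: geometric_bound_egs. Qed.

Lemma degs_taylory x y h :
  `|degs b x (y + h) - degs b x y - h * degs (fun n k => b n.+1 k) x y| <=
    M * L ^+ 2 * h ^+ 2 * expR (L * (`|y| + `|h|)) * expR (K * `|x|).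
Proof.
have b1 z := geometric_bound_egs z.
(* The remainders of the inner series are themselves geometrically bounded in k, so their outer
   series is bounded by [egs_le]. *)
pose t k := egs (b ^~ k) (y + h) - egs (b ^~ k) y - h * egs (fun n => b n.+1 k) y.
have tM : geometric_bound t (M * L ^+ 2 * h ^+ 2 * expR (L * (`|y| + `|h|))) K.
  move=> k; apply: le_trans (egs_taylor2 _ _ L0 (geometric_bound_row k)) _.
  by rewrite le_eqVlt; apply/orP; left; apply/eqP; ring.
suff -> : degs b x (y + h) - degs b x y - h * degs (fun n k => b n.+1 k) x y = egs t x.
  exact: egs_le.
have b3 : geometric_bound (fun k => egs (fun n => b n.+1 k) y) (M * L * expR (L * `|y|)) K.
  move=> k; rewrite mulrAC; apply: egs_le => // n.
  by rewrite mulrAC; exact: geometric_bound2_shifty.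
pose t1 k := 1 * egs (b ^~ k) y + t k.
have t1M : geometric_bound t1 (M * expR (L * `|y|) + M * L ^+ 2 * h ^+ 2 * expR (L * (`|y| + `|h|))) K.
  by move=> k; rewrite /t1 mul1r mulrDl (le_trans (ler_normD _ _)) //; apply: lerD; [exact: b1|exact: tM].
have -> : degs b x (y + h) = egs (fun k => h * egs (fun n => b n.+1 k) y + t1 k) x.
  by congr egs; apply/funext => k; rewrite /t1 /t; ring.
rewrite (egs_lin _ _ K0 b3 t1M) (egs_lin _ _ K0 (b1 y) tM) /degs; ring.
Qed.

End Bounded.

(** Derivatives along lines are all that is used later: climbs and drops move on lines in (x, th),
    and so do the points when one of u1, u2 varies. *)
Lemma degs_is_derive b M L K x0 y0 h k t0 : 0 <= L -> 0 <= K ->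
  geometric_bound2 b M L K ->
  is_derive (t0 : R) 1 (fun t => degs b (x0 + t * h) (y0 + t * k))
    (h * degs (fun n k => b n k.+1) (x0 + t0 * h) (y0 + t0 * k) +
     k * degs (fun n k => b n.+1 k) (x0 + t0 * h) (y0 + t0 * k)).
Proof.
move=> L0 K0 bM; set x := x0 + t0 * h; set y := y0 + t0 * k.
have M0 := geometric_bound2_ge0 bM.
have bxM := geometric_bound2_shiftx bM.
have bxyM := geometric_bound2_shifty bxM.
set bx := (fun n k => b n k.+1) in bxM bxyM *.
set by_ := (fun n k => b n.+1 k).
pose y' := `|y| + `|k|; pose x' := `|x| + `|h|.
pose A := M * expR (L * y') * K ^+ 2 * h ^+ 2 * expR (K * x').
pose B := `|h| * `|k| * `|degs (fun n k => bx n.+1 k) x y|.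
pose B' := `|h| * (M * K * L ^+ 2 * k ^+ 2 * expR (L * y') * expR (K * x')).
pose C := M * L ^+ 2 * k ^+ 2 * expR (L * y') * expR (K * x').
apply: (@quadratic_is_derive _ _ _ (A + B + B' + C)) => t t1.
rewrite [(t0 + t) * h]mulrDl [(t0 + t) * k]mulrDl !addrA -/x -/y.
have ht : `|t * h| <= `|h| by rewrite normrM ler_piMl.
have kt : `|t * k| <= `|k| by rewrite normrM ler_piMl.
have ey : `|y + t * k| <= y' by rewrite (le_trans (ler_normD _ _)) // lerD2l.
have eL z z' : z <= z' -> expR (L * z) <= expR (L * z') by move=> zz; rewrite ler_expR ler_wpM2l.
have eK z z' : z <= z' -> expR (K * z) <= expR (K * z') by move=> zz; rewrite ler_expR ler_wpM2l.
(* The increment is split into a step in x at the displaced y, the variation in y of the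
   x-derivative (a remainder and a mixed term), and a step in y. Each piece is O(t^2), with bounds
   A, B', B, C. *)
have -> : degs b (x + t * h) (y + t * k) - degs b x y - t * (h * degs bx x y + k * degs by_ x y) =
  (degs b (x + t * h) (y + t * k) - degs b x (y + t * k) - t * h * degs bx x (y + t * k))
  + (t * h) * (degs bx x (y + t * k) - degs bx x y - t * k * degs (fun n k => bx n.+1 k) x y)
  + (t * h) * (t * k * degs (fun n k => bx n.+1 k) x y)
  + (degs b x (y + t * k) - degs b x y - t * k * degs by_ x y) by ring.
have t2 : 0 <= t ^+ 2 by exact: sqr_ge0.
have LE (X Y Z W X' Y' Z' W' : R) : `|X| <= X' -> `|Y| <= Y' -> `|Z| <= Z' -> `|W| <= W' ->
    `|X + Y + Z + W| <= X' + Y' + Z' + W'.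
  move=> a1 a2 a3 a4; apply: le_trans (ler_normD _ _) _; apply: lerD a4.
  apply: le_trans (ler_normD _ _) _; apply: lerD a3.
  by apply: le_trans (ler_normD _ _) _; exact: lerD.
rewrite (_ : (A + B + B' + C) * t ^+ 2 = A * t ^+ 2 + B' * t ^+ 2 + B * t ^+ 2 + C * t ^+ 2); last by ring.
have E0 z : 0 <= expR z :> R by exact: expR_ge0.
have K2 := sqr_ge0 K. have L2 := sqr_ge0 L. have h2 := sqr_ge0 h. have k2 := sqr_ge0 k.
have eyL : expR (L * `|y + t * k|) <= expR (L * y') by exact: eL.
have exK : expR (K * (`|x| + `|t * h|)) <= expR (K * x') by apply: eK; rewrite lerD2l.
have ey2 : expR (L * (`|y| + `|t * k|)) <= expR (L * y') by apply: eL; rewrite lerD2l.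
have ex2 : expR (K * `|x|) <= expR (K * x') by apply: eK; rewrite lerDl.
apply: LE.
- apply: le_trans (degs_taylorx L0 K0 bM _ _ _) _.
  rewrite (_ : A * t ^+ 2 = M * expR (L * y') * K ^+ 2 * (t * h) ^+ 2 * expR (K * x')); last by rewrite /A; ring.
  have th2 := sqr_ge0 (t * h).
  apply: ler_pM => //; first by do 3! apply: mulr_ge0 => //.
  by do 2! (apply: ler_wpM2r => //); exact: ler_wpM2l.
- rewrite normrM (_ : B' * t ^+ 2 = `|h| * (M * K * L ^+ 2 * (t * k) ^+ 2 * expR (L * y') * expR (K * x'))); last by rewrite /B'; ring.
  apply: ler_pM => //.
  apply: le_trans (degs_taylory L0 K0 bxM _ _ _) _.
  have tk2 := sqr_ge0 (t * k).
  have c0 : 0 <= M * K * L ^+ 2 * (t * k) ^+ 2 by do 3! apply: mulr_ge0 => //.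
  apply: ler_pM => //; first exact: mulr_ge0.
  exact: ler_wpM2l.
- rewrite !normrM (_ : B * t ^+ 2 = `|t| * `|h| * (`|t| * `|k| * `|degs (fun n k => bx n.+1 k) x y|)) //.
  by rewrite /B -(real_normK (num_real t)); ring.
- apply: le_trans (degs_taylory L0 K0 bM _ _ _) _.
  rewrite (_ : C * t ^+ 2 = M * L ^+ 2 * (t * k) ^+ 2 * expR (L * y') * expR (K * x')); last by rewrite /C; ring.
  have tk2 := sqr_ge0 (t * k).
  have c0 : 0 <= M * L ^+ 2 * (t * k) ^+ 2 by do 2! apply: mulr_ge0 => //.
  apply: ler_pM => //; first exact: mulr_ge0.
  exact: ler_wpM2l.
Qed.

Lemma degs_lin b b' M M' L K c x y : 0 <= L -> 0 <= K ->
  geometric_bound2 b M L K -> geometric_bound2 b' M' L K ->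
  degs (fun n k => c * b n k + b' n k) x y = c * degs b x y + degs b' x y.
Proof.
move=> L0 K0 bM bM'; rewrite /degs -(egs_lin _ _ K0 (geometric_bound_egs L0 bM y) (geometric_bound_egs L0 bM' y)).
congr egs; apply/funext => k.
exact: egs_lin L0 (geometric_bound_row bM k) (geometric_bound_row bM' k).
Qed.

Lemma measurable_egs d (T : measurableType d) (a : T -> nat -> R) (u : T -> R) (M : T -> R) K :
  0 <= K -> (forall z, geometric_bound (a z) (M z) K) ->
  (forall k, measurable_fun setT (a ^~ k)) -> measurable_fun setT u ->
  measurable_fun setT (fun z => egs (a z) (u z)).
Proof.
move=> K0 aM ma mu; pose h n z := series (fun k => a z k * exp_coeff (u z) k) n.
apply: (@measurable_fun_cvg _ _ _ setT h) => [n|z _]; last exact: cvg_egs (aM z).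
rewrite /h; under eq_fun do rewrite seriesEnat /=.
apply: measurable_sum => k; apply: measurable_funM; first exact: ma.
by apply: measurable_funM => //; exact: measurable_funX.
Qed.

Lemma measurable_degs d (T : measurableType d) b M L K (u v : T -> R) :
  0 <= L -> 0 <= K -> geometric_bound2 b M L K ->
  measurable_fun setT u -> measurable_fun setT v ->
  measurable_fun setT (fun z => degs b (u z) (v z)).
Proof.
move=> L0 K0 bM mu mv.
apply: (@measurable_egs _ _ _ _ (fun z => M * expR (L * `|v z|)) K) => // [z|k].
  exact: geometric_bound_egs.
apply: (@measurable_egs _ _ _ _ (fun=> M * K ^+ k) L) => // z.
exact: geometric_bound_row.
Qed.

Lemma degsZ b M L K c x y : 0 <= L -> 0 <= K -> geometric_bound2 b M L K ->
  degs (fun n k => c * b n k) x y = c * degs b x y.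
Proof.
move=> L0 K0 bM; have e := degs_lin (c - 1) x y L0 K0 bM bM.
transitivity ((c - 1) * degs b x y + degs b x y); last by ring.
have -> : (fun n k => c * b n k) = (fun n k => (c - 1) * b n k + b n k).
  by apply/funext => n; apply/funext => k; ring.
exact: e.
Qed.

End DoubleSeries.

(** * The candidate solution *)

Section AdjustmentRate.
Context {R : realType}.
Variables (lam mu p s : R).
Hypotheses (lam0 : 0 < lam) (mu0 : 0 < mu) (p0 : 0 < p) (s0 : 0 <= s)
  (net_profit : lam < mu * p).

Let g := adjustment_rate lam mu p s.
Let m := mu * p - lam - s.
Let disc := m ^+ 2 + 4 * p * s * mu.

Let disc_ge0 : 0 <= disc.
Proof. by positivity. Qed.

Lemma adjustment_rate_root : p * g ^+ 2 = m * g + s * mu.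
Proof.
have /(congr1 (fun z => (z - m ^+ 2) / (4 * p))) := sqr_sqrtr disc_ge0.
have pN : p != 0 by rewrite gt_eqF.
rewrite /g /adjustment_rate -/m -/disc; set q := Num.sqrt disc => e.
have e2 : s * mu = (q ^+ 2 - m ^+ 2) / (4 * p) by rewrite e /disc; field.
by rewrite e2; field.
Qed.

Lemma adjustment_rate_gt0 : 0 < g.
Proof.
rewrite /g /adjustment_rate -/m -/disc divr_gt0 ?mulr_gt0 //.
have [s00|s1] := eqVneq s 0.
  by rewrite ltr_pwDl ?sqrtr_ge0 // /m s00 subr0 subr_gt0.
have {}s1 : 0 < s by rewrite lt_neqAle eq_sym s1.
rewrite -ltrBlDl sub0r; apply: le_lt_trans (ler_norm _) _.
rewrite normrN -sqrtr_sqr ltr_sqrt ?ltrDl ?mulr_gt0 //.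
by rewrite ltr_pwDr ?sqr_ge0 //; positivity.
Qed.

Lemma adjustment_rate_lt : g < mu.
Proof.
rewrite /g /adjustment_rate -/m -/disc ltr_pdivrMr ?mulr_gt0 // -ltrBrDl.
have r0 : 0 < mu * p + lam + s by rewrite ltr_wpDr // addr_gt0 // mulr_gt0.
have -> : mu * (2 * p) - m = mu * p + lam + s by rewrite /m; ring.
rewrite -(gtr0_norm r0) -sqrtr_sqr ltr_sqrt ?exprn_gt0 //.
rewrite -subr_gt0 (_ : _ - disc = 4 * p * mu * lam); last by rewrite /disc /m; ring.
by rewrite !mulr_gt0.
Qed.

(** The quadratic equation of g factors as (lam + s + g p)(mu - g) = lam mu. The right-hand side is
    the mean of e^{-(s + g p) v} over a climb, the form needed when integrating past the meeting
    time. *)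
Lemma adjustment_coefE : adjustment_coef lam mu p s = lam / (lam + s + g * p).
Proof.
rewrite /adjustment_coef -/g.
have g0 := adjustment_rate_gt0.
have muN : mu != 0 by rewrite gt_eqF.
have dN : lam + s + g * p != 0.
  have d0 : 0 < lam + s by rewrite ltr_wpDr.
  by rewrite gt_eqF //; positivity.
have root := adjustment_rate_root.
have -> : 1 - g / mu = (mu - g) / mu by field.
apply/eqP; rewrite eqr_div //; apply/eqP; rewrite mulrC.
have -> : (lam + s + g * p) * (mu - g) = lam * mu + s * mu + m * g - p * g ^+ 2 by rewrite /m; ring.
by rewrite root; ring.
Qed.

(** The product (lam + s + beta p)(mu - beta) is concave in beta, equals lam mu at beta = g and is
    at least lam mu at beta = 0, hence exceeds it strictly in between; g / 2 is such a point. *)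
Lemma half_adjustment_rate_contraction :
  lam / (lam + s + g / 2 * p) * (mu / (mu - g / 2)) < 1.
Proof.
have g0 := adjustment_rate_gt0; have gm := adjustment_rate_lt.
have root := adjustment_rate_root.
have d0 : 0 < lam + s by rewrite ltr_wpDr.
have d1 : 0 < lam + s + g / 2 * p by positivity.
have d2 : 0 < mu - g / 2 by rewrite subr_gt0; lra.
rewrite mulf_div ltr_pdivrMr ?mulr_gt0 // mul1r -subr_gt0.
have -> : (lam + s + g / 2 * p) * (mu - g / 2) - lam * mu =
  s * mu / 2 + p * g ^+ 2 / 4 + (m * g + s * mu - p * g ^+ 2) / 2 by rewrite /m; field.
rewrite root subrr mul0r addr0 -root ltr_wpDl //; positivity.
Qed.

End AdjustmentRate.

(** At s = 0 the discriminant is the square of mu p - lam, which is positive by the net profit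
    condition. For p = p2 the root is [gamma2]. *)
Lemma adjustment_rate0 (R : realType) (lam mu p : R) : 0 < p -> lam < mu * p ->
  adjustment_rate lam mu p 0 = mu - lam / p.
Proof.
move=> p0 np; have pN : p != 0 by rewrite gt_eqF.
rewrite /adjustment_rate subr0 !mulr0 mul0r addr0 sqrtr_sqr ger0_norm ?subr_ge0 ?ltW //.
by field.
Qed.

Section Candidate.
Context {R : realType}.
Variables (lam mu p1 p2 s : R).
Hypotheses (lam0 : 0 < lam) (mu0 : 0 < mu) (p20 : 0 < p2) (p21 : p2 < p1)
  (s0 : 0 <= s) (net_profit : lam < mu * p2).

Let g := adjustment_rate lam mu p2 s.
Let nu := mu - g.

(* Coefficients of e^{mu x} cand_phi x th, which satisfies
     D_th (D_x v) = p1 D_x^2 v - (p1 mu + lam + s) D_x v + lam mu v.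
   The first row is the one-dimensional solution e^{- g x}, reached at th = 0;
   the first column is the condition cand_phi 0 th = 1. *)
Fixpoint cand_coef n : nat -> R :=
  if n is n'.+1 then
    fun k => if k is k'.+1 then
      p1 * cand_coef n' k'.+2 - (p1 * mu + lam + s) * cand_coef n' k'.+1
        + lam * mu * cand_coef n' k'
    else 0
  else fun k => nu ^+ k.

(** The number L for which the recursion, with absolute values of its coefficients, sends nu^k to
    exactly L nu^(k+1); hence the bound L^n nu^k on the array. *)
Definition cand_growth := p1 * nu + (p1 * mu + lam + s) + lam * mu / nu.

Definition cand_phi x th : R := expR (- mu * x) * degs cand_coef x th.

(** Forced by phi_x = mu (psi - phi): in phi + phi_x / mu the derivative of e^{-mu x} cancels phi,
    and only the shift in k remains. *)
Definition cand_psi x th : R :=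
  expR (- mu * x) / mu * degs (fun n k => cand_coef n k.+1) x th.

Definition cand_psix x th : R :=
  expR (- mu * x) / mu * degs (fun n k => cand_coef n k.+2) x th - mu * cand_psi x th.

Definition cand_phith x th : R :=
  expR (- mu * x) * degs (fun n k => cand_coef n.+1 k) x th.

Let p10 : 0 < p1. Proof. exact: lt_trans p21. Qed.
Let g0 : 0 < g. Proof. exact: adjustment_rate_gt0. Qed.
Let nu0 : 0 < nu. Proof. by rewrite subr_gt0; exact: adjustment_rate_lt. Qed.
Let c0 : 0 < p1 * mu + lam + s.
Proof. by rewrite ltr_wpDr // addr_gt0 // mulr_gt0. Qed.

Lemma cand_growth_ge0 : 0 <= cand_growth.
Proof. by rewrite /cand_growth; positivity. Qed.

Let coef_bound : geometric_bound2 cand_coef 1 cand_growth nu.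
Proof.
have L0 := cand_growth_ge0.
elim=> [|n IH] k; first by rewrite expr0 !mul1r /= normrX gtr0_norm.
have {}IH j : `|cand_coef n j| <= cand_growth ^+ n * nu ^+ j by have := IH j; rewrite mul1r.
case: k => [|k] /=; first by rewrite normr0; positivity.
apply: (@le_trans _ _ (p1 * (cand_growth ^+ n * nu ^+ k.+2) + (p1 * mu + lam + s) * (cand_growth ^+ n * nu ^+ k.+1) + lam * mu * (cand_growth ^+ n * nu ^+ k))).
  apply: le_trans (ler_normD _ _) _; apply: lerD; last first.
    by rewrite normrM gtr0_norm ?mulr_gt0 //; apply: ler_wpM2l; [positivity|exact: IH].
  apply: le_trans (ler_normB _ _) _; apply: lerD.
    by rewrite normrM gtr0_norm //; apply: ler_wpM2l; [positivity|exact: IH].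
  by rewrite normrM gtr0_norm //; apply: ler_wpM2l; [positivity|exact: IH].
rewrite le_eqVlt; apply/orP; left; apply/eqP.
rewrite mul1r [cand_growth ^+ n.+1]exprS {4}/cand_growth !exprS.
have nuN : nu != 0 by rewrite gt_eqF.
by field.
Qed.

Let nu_ge0 : 0 <= nu := ltW nu0.
Let coef_boundx := geometric_bound2_shiftx coef_bound.
Let coef_boundxx := geometric_bound2_shiftx coef_boundx.

Lemma egs_const (a : nat -> R) x : (forall k, a k.+1 * exp_coeff x k.+1 = 0) ->
  egs a x = a 0%N.
Proof.
move=> a0; apply/cvg_lim => //; rewrite -cvg_shiftS; apply: cvg_near_cst.
apply: nearW => n; rewrite seriesEnat /= big_nat_recl // exp_coeff0 mulr1 big1 ?addr0 //.
Qed.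

Lemma cand_phi0 th : cand_phi 0 th = 1.
Proof.
rewrite /cand_phi mulr0 expR0 mul1r /degs egs_const; last first.
  by move=> k; rewrite /exp_coeff /= expr0n /= mul0r mulr0.
by rewrite egs_const /= ?expr0 // => k; rewrite mul0r.
Qed.

Let degs_th0 (b : nat -> nat -> R) x : degs b x 0 = egs (b 0%N) x.
Proof.
by congr egs; apply/funext => k; rewrite egs_const // => n; rewrite /exp_coeff /= expr0n /= mul0r mulr0.
Qed.

Let egs_nu c x : egs (fun k => c * nu ^+ k) x = c * expR (nu * x).
Proof.
apply/cvg_lim => //.
rewrite (_ : series _ = c *: series (exp_coeff (nu * x))).
  by apply: cvgZr; exact: is_cvg_series_exp_coeff.
apply/funext => n; rewrite [RHS](_ : _ = c * series (exp_coeff (nu * x)) n) // !seriesEnat /= mulr_sumr.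
by apply: eq_bigr => k _; rewrite exp_coeffZ mulrA.
Qed.

Lemma cand_phi_th0 x : cand_phi x 0 = expR (- g * x).
Proof.
rewrite /cand_phi degs_th0 /= (_ : (fun k => nu ^+ k) = (fun k => 1 * nu ^+ k)); last first.
  by apply/funext => k; rewrite mul1r.
by rewrite egs_nu mul1r -expRD; congr expR; rewrite /nu; ring.
Qed.

Lemma cand_psi_th0 x : cand_psi x 0 = adjustment_coef lam mu p2 s * expR (- g * x).
Proof.
rewrite /cand_psi degs_th0 /= (_ : (fun k => nu ^+ k.+1) = (fun k => nu * nu ^+ k)); last first.
  by apply/funext => k; rewrite exprS.
rewrite egs_nu (_ : - g * x = - mu * x + nu * x); last by rewrite /nu; ring.
by rewrite expRD /adjustment_coef -/g /nu; field; rewrite gt_eqF.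
Qed.

(** The series grows at most like e^{nu x} with nu = mu - g, so the prefactor e^{-mu x} turns this
    into decay at rate g, at the price of a factor depending on th alone. *)
Let expR_bound c M x th b : 0 <= x -> 0 <= th -> 0 <= c ->
  geometric_bound2 b M cand_growth nu ->
  `|c * expR (- mu * x) * degs b x th| <= c * M * expR (cand_growth * th) * expR (- g * x).
Proof.
move=> x0 th0 c00 bM; rewrite normrM ger0_norm; last by positivity.
have := degs_le cand_growth_ge0 nu_ge0 bM x th.
rewrite (ger0_norm x0) (ger0_norm th0) => le.
apply: le_trans (ler_wpM2l _ le) _; first by positivity.
rewrite (_ : - g * x = - mu * x + nu * x); last by rewrite /nu; ring.
by rewrite expRD le_eqVlt; apply/orP; left; apply/eqP; ring.
Qed.

Lemma cand_phi_le x th : 0 <= x -> 0 <= th ->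
  `|cand_phi x th| <= expR (cand_growth * th) * expR (- g * x).
Proof.
move=> x0 th0; have := expR_bound x0 th0 ler01 coef_bound.
by rewrite !mul1r.
Qed.

Lemma cand_psi_le x th : 0 <= x -> 0 <= th ->
  `|cand_psi x th| <= expR (cand_growth * th) * expR (- g * x).
Proof.
move=> x0 th0; have mui : 0 <= mu^-1 by rewrite invr_ge0 ltW.
have nu1 : mu^-1 * (1 * nu) <= 1.
  by rewrite mul1r mulrC ler_pdivrMr // mul1r lerBlDr lerDl ltW.
have := expR_bound x0 th0 mui coef_boundx.
rewrite /cand_psi [_ / mu]mulrC => /le_trans; apply.
by rewrite -[X in X <= _]mulrA; apply: ler_piMl nu1; positivity.
Qed.

Let is_derive_exp_degs c b M x0 th0 h k (t : R) :
  geometric_bound2 b M cand_growth nu ->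
  is_derive t 1 (fun t => c * expR (- mu * (x0 + t * h)) * degs b (x0 + t * h) (th0 + t * k))
    (c * expR (- mu * (x0 + t * h)) *
       (h * (degs (fun n k => b n k.+1) (x0 + t * h) (th0 + t * k)
             - mu * degs b (x0 + t * h) (th0 + t * k))
        + k * degs (fun n k => b n.+1 k) (x0 + t * h) (th0 + t * k))).
Proof.
move=> bM.
have dE := degs_is_derive x0 th0 h k t cand_growth_ge0 nu_ge0 bM.
have dX : is_derive t 1 (fun t => - mu * (x0 + t * h)) (- mu * h).
  apply: is_derive_eq; rewrite /GRing.scale /=; ring.
have dX' : is_derive t 1 (fun t => expR (- mu * (x0 + t * h))) (expR (- mu * (x0 + t * h)) * (- mu * h)).
  exact: is_derive1_comp (is_derive_expR _) dX.
have dX2 : is_derive t 1 (fun t => c * expR (- mu * (x0 + t * h))) (c * (expR (- mu * (x0 + t * h)) * (- mu * h))).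
  exact: is_deriveZ.
apply: is_derive_eq (is_deriveM dX2 dE) _.
by rewrite /GRing.scale /=; ring.
Qed.

Lemma cand_phi_derive (x0 th0 h k t : R) :
  is_derive t 1 (fun t => cand_phi (x0 + t * h) (th0 + t * k))
    (h * (mu * cand_psi (x0 + t * h) (th0 + t * k) - mu * cand_phi (x0 + t * h) (th0 + t * k))
     + k * cand_phith (x0 + t * h) (th0 + t * k)).
Proof.
have := is_derive_exp_degs 1 x0 th0 h k t coef_bound.
rewrite (_ : (fun t => _) = (fun t => cand_phi (x0 + t * h) (th0 + t * k))); last first.
  by apply/funext => z; rewrite mul1r.
move=> dE; apply: is_derive_eq dE _.
by rewrite /cand_psi /cand_phi /cand_phith; field; rewrite gt_eqF.
Qed.

(** The factor of k is psi_th as the second equation prescribes it: the recursion for [cand_coef],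
    one column to the right, is that equation written on coefficients. *)
Lemma cand_psi_derive (x0 th0 h k t : R) :
  is_derive t 1 (fun t => cand_psi (x0 + t * h) (th0 + t * k))
    (h * cand_psix (x0 + t * h) (th0 + t * k)
     + k * (p1 * cand_psix (x0 + t * h) (th0 + t * k)
         - (lam + s) * cand_psi (x0 + t * h) (th0 + t * k)
         + lam * cand_phi (x0 + t * h) (th0 + t * k))).
Proof.
have := is_derive_exp_degs mu^-1 x0 th0 h k t coef_boundx.
rewrite (_ : (fun t => _) = (fun t => cand_psi (x0 + t * h) (th0 + t * k))); last first.
  by apply/funext => z; rewrite /cand_psi [_ / mu]mulrC.
move=> dE; apply: is_derive_eq dE _.
set x := x0 + t * h; set th := th0 + t * k.
(* [degs_lin] combines two arrays at a time, so the last two terms of the recursion need a joint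
   bound of their own. *)
have b3 : geometric_bound2 (fun n k => - (p1 * mu + lam + s) * cand_coef n k.+1 + lam * mu * cand_coef n k)
    ((p1 * mu + lam + s) * nu + lam * mu) cand_growth nu.
  move=> n j; have := coef_boundx n j; have := coef_bound n j; rewrite !mul1r => e1 e2.
  rewrite [X in _ <= X](_ : _ = (p1 * mu + lam + s) * (nu * cand_growth ^+ n * nu ^+ j)
    + lam * mu * (cand_growth ^+ n * nu ^+ j)); last by ring.
  apply: le_trans (ler_normD _ _) _; apply: lerD.
    by rewrite normrM normrN (gtr0_norm c0); apply: ler_wpM2l; [positivity|].
  by rewrite normrM (gtr0_norm (mulr_gt0 lam0 mu0)); apply: ler_wpM2l; [positivity|].
have -> : degs (fun n k => cand_coef n.+1 k.+1) x th =
    p1 * degs (fun n k => cand_coef n k.+2) x th +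
    (- (p1 * mu + lam + s) * degs (fun n k => cand_coef n k.+1) x th + lam * mu * degs cand_coef x th).
  have b4 : geometric_bound2 (fun n k => lam * mu * cand_coef n k) (lam * mu) cand_growth nu.
    move=> n j; have := coef_bound n j; rewrite !mul1r => e1.
    by rewrite normrM (gtr0_norm (mulr_gt0 lam0 mu0)) -[X in _ <= X]mulrA; apply: ler_wpM2l; [positivity|].
  have L0 := cand_growth_ge0.
  have e0 := degsZ (lam * mu) x th L0 nu_ge0 coef_bound.
  have e1 := degs_lin (- (p1 * mu + lam + s)) x th L0 nu_ge0 coef_boundx b4.
  have e2 := degs_lin p1 x th L0 nu_ge0 coef_boundxx b3.
  transitivity (degs (fun n k => p1 * cand_coef n k.+2 + (- (p1 * mu + lam + s) * cand_coef n k.+1 + lam * mu * cand_coef n k)) x th).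
    have -> : (fun n k => cand_coef n.+1 k.+1) = (fun n k => p1 * cand_coef n k.+2 + (- (p1 * mu + lam + s) * cand_coef n k.+1 + lam * mu * cand_coef n k)); last by [].
    by apply/funext => n; apply/funext => j /=; rewrite mulNr addrA.
  exact: (eq_trans e2 (congr1 _ (eq_trans e1 (congr1 _ e0)))).
rewrite /cand_psix /cand_psi /cand_phi -/x -/th.
by field; rewrite gt_eqF.
Qed.

Lemma measurable_cand_phi d (T : measurableType d) (u v : T -> R) :
  measurable_fun setT u -> measurable_fun setT v ->
  measurable_fun setT (fun z => cand_phi (u z) (v z)).
Proof.
move=> mu_ mv; apply: measurable_funM; last exact: (measurable_degs cand_growth_ge0 nu_ge0 coef_bound).
by apply: measurableT_comp => //; exact: measurable_funM.
Qed.

Lemma measurable_cand_psi d (T : measurableType d) (u v : T -> R) :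
  measurable_fun setT u -> measurable_fun setT v ->
  measurable_fun setT (fun z => cand_psi (u z) (v z)).
Proof.
move=> mu_ mv; apply: measurable_funM; last exact: (measurable_degs cand_growth_ge0 nu_ge0 coef_boundx).
apply: measurable_funM => //.
by apply: measurableT_comp => //; exact: measurable_funM.
Qed.

End Candidate.

(** * Exponential laws and Markov chains *)

Section Density.
Context d (T : measurableType d) (R : realType).
Variables (m nu : {measure set T -> \bar R}) (q : T -> R).
Hypotheses (q0 : forall x, 0 <= q x) (mq : measurable_fun setT q)
  (nuE : forall A, measurable A -> (nu A = \int[m]_(x in A) (q x)%:E)%E).

Import HBNNSimple.
Local Open Scope ereal_scope.

Let integral_density_nnsfun (h : {nnsfun T >-> R}) :
  \int[nu]_x (h x)%:E = \int[m]_x ((h x)%:E * (q x)%:E).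
Proof.
have mqE : measurable_fun setT (EFin \o q) by exact/measurable_EFinP.
have h0 r x : (0 <= r * \1_(h @^-1` [set r]) x)%R.
  rewrite indicE; have [|_] := boolP (_ \in _); last by rewrite mulr0.
  by rewrite inE /= => <-; rewrite mulr1.
rewrite integralT_nnsfun sintegralE.
under [RHS]eq_integral.
  move=> x xD; rewrite fimfunE -fsumEFin// ge0_mule_fsuml; last first.
    by move=> r; rewrite lee_fin.
  over.
rewrite [RHS]ge0_integral_fsum//; last 2 first.
  - move=> r; apply: emeasurable_funM => //.
    by apply/measurable_EFinP; apply/measurableT_comp.
  - by move=> n x _; rewrite mule_ge0 ?lee_fin.
apply: eq_fsbigr => r _.
have mr : measurable (h @^-1` [set r]) by exact: measurable_sfunP.
rewrite nuE //.
under [RHS]eq_integral => x _ do rewrite EFinM -muleA.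
have [r0|r0] := leP 0%R r.
  rewrite ge0_integralZl//; last 2 first.
  - by apply: emeasurable_funM => //; apply/measurable_EFinP.
  - by move=> x _; rewrite mule_ge0 ?lee_fin.
  congr (_ * _); rewrite integral_mkcond; apply: eq_integral => x _.
  by rewrite patchE indicE; case: ifPn => xr; rewrite ?mul1e ?mul0e.
rewrite preimage_nnfun0 // integral_set0 mule0 integral0_eq // => x _.
by rewrite indicE in_set0 mul0e mule0.
Qed.

(** The identity holds for simple functions, where [nuE] applies to level sets, and passes to
    increasing limits on both sides. *)
Lemma ge0_integral_density (f : T -> \bar R) :
  measurable_fun setT f -> (forall x, 0 <= f x) ->
  \int[nu]_x f x = \int[m]_x (f x * (q x)%:E).
Proof.
move=> mf f0; pose f_ := nnsfun_approx measurableT mf.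
have mqE : measurable_fun setT (EFin \o q) by exact/measurable_EFinP.
transitivity (lim (\int[nu]_x (f_ n x)%:E @[n --> \oo])).
  rewrite -monotone_convergence//=.
  - apply: eq_integral => ? /[!inE] xD; apply/esym/cvg_lim => //=.
    exact: cvg_nnsfun_approx.
  - by move=> n; exact/measurable_EFinP/measurable_funTS.
  - by move=> n ? _; rewrite lee_fin.
  - by move=> ? _ ? ? mn; rewrite lee_fin; exact/lefP/nd_nnsfun_approx.
under eq_fun do rewrite integral_density_nnsfun.
rewrite -monotone_convergence//=.
- apply: eq_integral => x _; apply/cvg_lim => //=.
  apply: cvgeZr => //; exact: cvg_nnsfun_approx.
- by move=> n; apply: emeasurable_funM => //; exact/measurable_EFinP/measurable_funTS.
- by move=> n x _; rewrite mule_ge0 ?lee_fin.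
- move=> x _ i j ij; rewrite lee_wpmul2r ?lee_fin //.
  exact/lefP/nd_nnsfun_approx.
Qed.

End Density.

Section ExponentialLaw.
Context d (T : measurableType d) (R : realType) (P : probability T R).

Lemma ge0_integral_exponential_law (rate : R) (X : {RV P >-> R}) (f : R -> \bar R) :
  0 < rate -> has_exponential_law rate X ->
  measurable_fun setT f -> (forall x, 0 <= f x)%E ->
  (\int[distribution P X]_x f x =
   \int[lebesgue_measure]_(x in `[0%R, +oo[) (f x * (rate * expR (- rate * x))%:E))%E.
Proof.
move=> r0 lawX mf f0.
(* lebesgue_measure is defined on measurableTypeR R, whose display is not that
   of R, the codomain of X. *)
have mX : @measurable_fun _ _ T (measurableTypeR R) setT X by exact: (measurable_funPT X).
pose X' : {mfun T >-> measurableTypeR R} := @mfun_Sub _ _ T (measurableTypeR R) X (mem_set mX).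
rewrite ge0_integral_distribution // -(@ge0_integral_distribution _ _ _ _ _ P X') //.
rewrite (@ge0_integral_density _ _ R lebesgue_measure (distribution P X') (exponential_pdf rate)) //.
- rewrite [RHS]integral_mkcond; apply: eq_integral => x _.
  rewrite /exponential_pdf !patchE; case: ifP => // _.
  by rewrite mule0.
- by move=> x; apply: exponential_pdf_ge0; exact: ltW.
- exact: measurable_exponential_pdf.
Qed.

Lemma exponential_law_ge0 (rate : R) (X : {RV P >-> R}) :
  has_exponential_law rate X -> P [set w | X w < 0] = 0%E.
Proof.
move=> lawX; have := lawX `]-oo, 0[%classic (measurable_itv _).
rewrite /distribution /pushforward /exponential_prob integral0_eq.
  by move=> <-; congr (P _); apply/seteqP; split => w /=; rewrite in_itv.
by move=> x; rewrite /= in_itv /= => x0; rewrite lt0_exponential_pdf.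
Qed.

End ExponentialLaw.

(** * Chains driven by independent innovations *)

Section MarkovChain.
Context d (T : measurableType d) (R : realType) (P : probability T R)
  dS (S : measurableType dS).
Variables (xi : nat -> {RV P >-> R}) (f : nat -> S * R -> S) (Z0 : T -> S).
Hypotheses (mf : forall n, measurable_fun setT (f n)) (mZ0 : measurable_fun setT Z0).

Fixpoint chain n (w : T) : S :=
  if n is n'.+1 then f n' (chain n' w, xi n' w) else Z0 w.

Lemma measurable_chain n : measurable_fun setT (chain n).
Proof.
elim: n => [|n IH]; first exact: mZ0.
apply: (measurableT_comp (mf n)).
by apply: measurable_fun_pair => //; exact: measurable_funPT.
Qed.

Let chainM n : {mfun T >-> S} := mfun_Sub (mem_set (measurable_chain n)).

Let measurable_pair n : measurable_fun setT (fun w => (chain n w, xi n w)).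
Proof. by apply: measurable_fun_pair; [exact: measurable_chain|exact: measurable_funPT]. Qed.

Let pairM n : {mfun T >-> (S * R)%type} := mfun_Sub (mem_set (measurable_pair n)).

Local Open Scope ereal_scope.

Let cylinder (J : seq nat) (B : nat -> set R) : set T :=
  \bigcap_(i in [set` J]) (xi i @^-1` B i).

Hypothesis chain_indep0 : forall C (J : seq nat) B, measurable C -> uniq J ->
  (forall i, measurable (B i)) ->
  P (Z0 @^-1` C `&` cylinder J B) = P (Z0 @^-1` C) * \prod_(i <- J) P (xi i @^-1` B i).

Let measurable_cylinder J B : (forall i, measurable (B i)) -> measurable (cylinder J B).
Proof.
move=> mB; apply: fin_bigcap_measurable => [|i _]; first exact: finite_seq.
by rewrite -[X in measurable X]setTI; exact: measurable_funPT.
Qed.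

(** The state at time n+1 is a function of the state at time n and of [xi n], so independence from a
    later cylinder has to be extended from rectangles to all measurable sets of such pairs. *)
Let chain_indep n : forall C J B, measurable C -> uniq J -> all (leq n) J ->
  (forall i, measurable (B i)) ->
  P (chain n @^-1` C `&` cylinder J B) = P (chain n @^-1` C) * \prod_(i <- J) P (xi i @^-1` B i).
Proof.
elim: n => [|n IH] C J B mC uJ nJ mB; first exact: chain_indep0.
have nJn : n \notin J by apply/negP => /(allP nJ); rewrite ltnn.
have nJ' : all (leq n) J by apply: sub_all nJ => i; exact: ltnW.
have mE := measurable_cylinder J mB.
pose pr := \prod_(i <- J) P (xi i @^-1` B i).
have pr_ge0 : 0 <= pr by rewrite /pr big_seq; apply: prode_ge0.
have pr_fin : pr \is a fin_num.
  rewrite /pr; elim/big_ind: _ => // [x y|i _]; first exact: fin_numM.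
  by apply: fin_num_measure; rewrite -[X in measurable X]setTI; exact: measurable_funPT.
have prE : (fine pr)%:E = pr by rewrite fineK.
pose c : {nonneg R} := NngNum (fine_ge0 pr_ge0).
(* [m1] is the law of the pair on the cylinder, [m2] its full law times the probability c of the
   cylinder. Both equal, on rectangles, the product of the law of the state with c times the law of
   [xi n], so they coincide, in particular on the preimage of C under f n. *)
pose m1 := pushforward (mrestr P mE) (pairM n).
pose m2 := mscale c (distribution P (pairM n)).
have rect A A' : measurable A -> measurable A' ->
    P (pairM n @^-1` (A `*` A')) = P (chain n @^-1` A) * P (xi n @^-1` A').
  move=> mA mA'; have := IH A [:: n] (fun=> A') mA isT.
  rewrite /= leqnn big_seq1 => <- //; congr (P _); apply/seteqP; split => w /=.
    by move=> [? ?]; split => // i /=; rewrite inE => /eqP ->.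
  by move=> [? h]; split => //; apply: (h n) => /=; rewrite inE.
have rectE A A' : measurable A -> measurable A' ->
    m1 (A `*` A') = distribution P (chainM n) A * mscale c (distribution P (xi n)) A'.
  (* The constraint on [xi n] joins the cylinder; n is not in J, so the other constraints are
     unchanged. *)
  move=> mA mA'; pose B' i := if i == n then A' else B i.
  have mB' i : measurable (B' i) by rewrite /B'; case: ifP.
  have B'E i : i \in J -> B' i = B i.
    by rewrite /B'; case: eqP => // -> ; rewrite (negbTE nJn).
  have := IH A (n :: J) B' mA; rewrite /= nJn uJ leqnn nJ' => /(_ isT isT mB').
  rewrite big_cons {2}/B' eqxx.
  rewrite (eq_big_seq (fun i => P (xi i @^-1` B i))); last by move=> i iJ; rewrite B'E.
  rewrite /mscale /distribution /pushforward /= prE [X in _ * X]muleC => <-.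
  rewrite /m1 /pushforward /mrestr; congr (P _); apply/seteqP; split => w /=.
    move=> [[? ?] h]; split => // i /=; rewrite inE => /orP[/eqP ->|iJ].
      by rewrite /B' eqxx.
    by rewrite B'E //; exact: h.
  move=> [? h]; split; first split => //.
    by have := h n; rewrite /= inE eqxx /B' eqxx; apply.
  by move=> i /= iJ; rewrite -B'E //; apply: h; rewrite /= inE iJ orbT.
have rectS A A' : measurable A -> measurable A' ->
    m2 (A `*` A') = distribution P (chainM n) A * mscale c (distribution P (xi n)) A'.
  move=> mA mA'; rewrite /m2 /mscale /distribution /pushforward /= muleCA; congr (_ * _).
  exact: rect.
have mQ : measurable (f n @^-1` C) by rewrite -[X in measurable X]setTI; exact: mf.
have := product_measure_unique rectE mQ.
rewrite (product_measure_unique rectS mQ).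
move=> /(_ (measurable_pair n)); rewrite /m1 /m2 /mscale /distribution /pushforward /mrestr /= /mscale /pushforward /mrestr /= prE muleC => <-.
by [].
Qed.

Lemma measurable_chain_step n (h : S -> \bar R) :
  measurable_fun setT h -> (forall z, 0 <= h z) ->
  measurable_fun setT (fun w => \int[distribution P (xi n)]_x h (f n (chain n w, x))).
Proof.
move=> mh h0.
have mhf : measurable_fun setT (h \o f n) by apply: measurableT_comp.
have hf0 z : 0 <= (h \o f n) z by exact: h0.
have mF : measurable_fun setT (fun z => \int[distribution P (xi n)]_x (h \o f n) (z, x)).
  exact: measurable_fun_fubini_tonelli_F.
exact: (measurableT_comp mF (measurable_chain n)).
Qed.

(** State and innovation have a product law, so Tonelli integrates the innovation first with the
    state frozen: the Markov property in integrated form. *)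
Lemma chain_step n (h : S -> \bar R) : measurable_fun setT h -> (forall z, 0 <= h z) ->
  \int[P]_w h (chain n.+1 w) =
  \int[P]_w \int[distribution P (xi n)]_x h (f n (chain n w, x)).
Proof.
move=> mh h0.
pose H z := \int[distribution P (xi n)]_x h (f n (z, x)).
have mhf : measurable_fun setT (h \o f n) by apply: measurableT_comp.
have rect A A' : measurable A -> measurable A' ->
    distribution P (pairM n) (A `*` A') = distribution P (chainM n) A * distribution P (xi n) A'.
  move=> mA mA'; have := @chain_indep n A [:: n] (fun=> A') mA isT.
  rewrite /= leqnn big_seq1 /distribution /pushforward /= => <- //; congr (P _); apply/seteqP; split => w /=.
    by move=> [? ?]; split => // i /=; rewrite inE => /eqP ->.
  by move=> [? hh]; split => //; apply: (hh n) => /=; rewrite inE.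
have -> : \int[P]_w h (chain n.+1 w) = \int[distribution P (pairM n)]_z (h \o f n) z.
  by rewrite ge0_integral_distribution // => z; exact: h0.
rewrite (eq_measure_integral (distribution P (chainM n) \x distribution P (xi n))); last first.
  by move=> A mA _; apply/esym; exact: product_measure_unique.
rewrite fubini_tonelli1 //; last by move=> z; exact: h0.
rewrite (@ge0_integral_distribution _ _ _ _ _ P (chainM n)) //.
- by apply: measurable_fun_fubini_tonelli_F => // z; exact: h0.
- by move=> z; apply: integral_ge0 => x _; exact: h0.
Qed.

End MarkovChain.

(** * Half-step identities *)

Section ExponentialIntegrals.
Context {R : realType}.
Implicit Types (f F : R -> R) (a b c k x : R).
Let leb := @lebesgue_measure R.

Lemma continuous_is_derive F f : (forall x : R, is_derive x 1 F (f x)) -> continuous F.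
Proof.
by move=> dF x; apply: differentiable_continuous; apply/derivable1_diffP; apply: ex_derive.
Qed.

Lemma FTC2_is_derive f F a b : a <= b -> continuous f ->
  (forall x : R, is_derive x 1 F (f x)) ->
  (\int[leb]_(x in `[a, b]) (f x)%:E = (F b - F a)%:E)%E.
Proof.
move=> ab cf dF; have [->|ab'] := eqVneq a b.
  by rewrite set_itv1 integral_set1 subrr.
have {ab ab'}ab : a < b by rewrite lt_neqAle ab'.
have cF := continuous_is_derive dF.
rewrite EFinB; apply: continuous_FTC2 => //.
- exact: continuous_subspaceT.
- split.
  + by move=> x _; exact: ex_derive.
  + by apply: cvg_at_right_filter; exact: cF.
  + by apply: cvg_at_left_filter; exact: cF.
- by move=> x _; rewrite derive1E derive_val.
Qed.

Lemma ge0_FTC2y_is_derive f F a l : (forall x, a <= x -> 0 <= f x) -> continuous f ->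
  (forall x : R, is_derive x 1 F (f x)) -> F x @[x --> +oo%R] --> l ->
  (\int[leb]_(x in `[a, +oo[) (f x)%:E = (l - F a)%:E)%E.
Proof.
move=> f0 cf dF Fl.
have cF := continuous_is_derive dF.
rewrite EFinB; apply: ge0_continuous_FTC2y => //.
- exact: continuous_subspaceT.
- by apply: cvg_at_right_filter; exact: cF.
- by move=> x _; rewrite derive1E derive_val.
Qed.

Lemma is_derive_expM c k x :
  is_derive x 1 (fun x => c * expR (k * x)) (c * k * expR (k * x)).
Proof.
have dX : is_derive x 1 (fun x => k * x) k.
  by apply: is_derive_eq; rewrite /GRing.scale /=; ring.
apply: is_derive_eq (is_deriveZ c (is_derive1_comp (is_derive_expR _) dX)) _.
by rewrite /GRing.scale /=; ring.
Qed.

Lemma continuous_expM c k : continuous (fun x => c * expR (k * x)).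
Proof. by apply: continuous_is_derive => x; exact: is_derive_expM. Qed.

Lemma cvg_expM c k : 0 < k -> c * expR (- k * x) @[x --> +oo%R] --> 0.
Proof.
move=> k0; rewrite -[X in _ --> X](mulr0 c); apply: cvgMr.
rewrite (_ : (fun x => expR (- k * x)) = (fun z => expR (- z)) \o (fun z => k * z)); last first.
  by apply/funext => x /=; rewrite mulNr.
apply: (@cvg_comp _ _ _ _ _ _ (pinfty_nbhs R)); last exact: cvgr_expR.
exact: gt0_cvgMry.
Qed.

Lemma integral_expM_itvcy a c k : 0 <= c -> 0 < k ->
  (\int[leb]_(x in `[a, +oo[) (c * expR (- k * x))%:E = (c / k * expR (- k * a))%:E)%E.
Proof.
move=> c0 k0.
have dF x : is_derive x 1 (fun x => - c / k * expR (- k * x)) (c * expR (- k * x)).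
  apply: is_derive_eq (is_derive_expM (- c / k) (- k) x) _.
  by field; rewrite gt_eqF.
have f0 x : a <= x -> 0 <= c * expR (- k * x) by move=> _; positivity.
rewrite (ge0_FTC2y_is_derive f0 (@continuous_expM c (- k)) dF (cvg_expM _ k0)).
by congr EFin; ring.
Qed.

End ExponentialIntegrals.

Section HalfStepIdentities.
Context {R : realType}.
Variables (lam mu p1 p2 s : R).
Hypotheses (lam0 : 0 < lam) (mu0 : 0 < mu) (p20 : 0 < p2) (p21 : p2 < p1)
  (s0 : 0 <= s) (net_profit : lam < mu * p2).

Let g := adjustment_rate lam mu p2 s.
Let psi := cand_psi lam mu p1 p2 s.
Let phi := cand_phi lam mu p1 p2 s.
Let leb := @lebesgue_measure R.

Let g0 : 0 < g. Proof. exact: adjustment_rate_gt0. Qed.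

(** The value of phi at the top of a climb of length v: the level rises with slope [p1] while the
    gap shrinks, then with slope [p2] and gap 0 once the lines have met. *)
Definition climb_phi (x th v : R) : R :=
  if v < th then phi (x + p1 * v) (th - v) else phi (x + p1 * th + p2 * (v - th)) 0.

(* The shift by M makes the integrand nonnegative, so that no integrability is
   required here and in integral_drop. *)
Lemma integral_climb x th M : 0 <= x -> 0 <= th ->
  (forall v, 0 <= v -> 0 <= expR (- s * v) * climb_phi x th v + M) ->
  (\int[leb]_(v in `[0%R, +oo[)
     ((expR (- s * v) * climb_phi x th v + M) * (lam * expR (- lam * v)))%:E
   = (psi x th + M)%:E)%E.
Proof.
move=> x0 th0 ge0.
pose G v := (expR (- s * v) * climb_phi x th v + M) * (lam * expR (- lam * v)).
pose G1 v := lam * expR (- (lam + s) * v) * phi (x + v * p1) (th + v * -1) + M * lam * expR (- lam * v).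
(* A primitive up to the meeting: along the direction (p1, -1) the second equation cancels the psi
   terms and leaves lam phi. *)
pose F1 v := - 1 * expR (- (lam + s) * v) * psi (x + v * p1) (th + v * -1) + - M * expR (- lam * v).
(* After the meeting phi is e^{-g level}, so the integrand is a sum of exponentials in v; [c2]
   collects what does not depend on v. *)
pose c2 := lam * expR (- g * (x + p1 * th - p2 * th)).
pose G2 v := c2 * expR (- (lam + s + g * p2) * v) + M * lam * expR (- lam * v).
pose F2 v := - c2 / (lam + s + g * p2) * expR (- (lam + s + g * p2) * v) + - M * expR (- lam * v).
have d00 : 0 < lam + s by rewrite ltr_wpDr.
have d0 : 0 < lam + s + g * p2 by positivity.
have dphi (v : R) := cand_phi_derive lam0 mu0 p20 p21 s0 x th p1 (-1) v.
have dpsi (v : R) := cand_psi_derive lam0 mu0 p20 p21 s0 x th p1 (-1) v.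
have dF1 (v : R) : is_derive v 1 F1 (G1 v).
  apply: is_derive_eq (is_deriveD (is_deriveM (is_derive_expM (-1) (- (lam + s)) v) (dpsi v)) (is_derive_expM (- M) (- lam) v)) _.
  by rewrite /G1 /GRing.scale /= /phi /psi; ring.
have dF2 (v : R) : is_derive v 1 F2 (G2 v).
  apply: is_derive_eq (is_deriveD (is_derive_expM _ _ v) (is_derive_expM (- M) (- lam) v)) _.
  by rewrite /G2; field; rewrite gt_eqF.
have cG1 : continuous G1.
  apply: (@continuous_is_derive _ _ _ (fun v => is_deriveD (is_deriveM (is_derive_expM lam (- (lam + s)) v) (dphi v)) (is_derive_expM (M * lam) (- lam) v))).
have cG2 : continuous G2.
  exact: (@continuous_is_derive _ _ _ (fun v => is_deriveD (is_derive_expM c2 (- (lam + s + g * p2)) v) (is_derive_expM (M * lam) (- lam) v))).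
have GG1 v : v < th -> G v = G1 v.
  move=> vth; rewrite /G /climb_phi vth /G1 (mulrC v p1) mulrN1.
  by rewrite (_ : - (lam + s) * v = - s * v + - lam * v) ?expRD; ring.
have GG2 v : th <= v -> G v = G2 v.
  move=> vth; rewrite /G /climb_phi ltNge vth /= /phi cand_phi_th0 -/g /G2 /c2.
  rewrite (_ : - (lam + s + g * p2) * v = - s * v + - lam * v + - (g * p2) * v); last by ring.
  rewrite (_ : - g * (x + p1 * th + p2 * (v - th)) = - g * (x + p1 * th - p2 * th) + - (g * p2) * v); last by ring.
  by rewrite !expRD; ring.
have G0 v : 0 <= v -> 0 <= G v by move=> v0; rewrite mulr_ge0 ?ge0 //; positivity.
have e2 : (\int[leb]_(v in `[th, +oo[) (G v)%:E = (0 - F2 th)%:E)%E.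
  have G20 v : th <= v -> 0 <= G2 v by move=> vth; rewrite -GG2 // G0 // (le_trans th0).
  have F20 : F2 v @[v --> +oo%R] --> (0 : R).
    by rewrite -[X in _ --> X]addr0; apply: cvgD; exact: cvg_expM.
  rewrite -(ge0_FTC2y_is_derive G20 cG2 dF2 F20).
  by apply: eq_integral => v; rewrite inE /= in_itv /= andbT => /GG2 ->.
have e1 : (\int[leb]_(v in `[0%R, th[) (G v)%:E = (F1 th - F1 0)%:E)%E.
  rewrite -(FTC2_is_derive th0 cG1 dF1).
  rewrite -integral_itv_bndo_bndc; last first.
    by apply/measurable_EFinP; apply: measurable_funTS; exact: continuous_measurable_fun.
  by apply: eq_integral => v; rewrite inE /= in_itv /= => /andP[_ /GG1 ->].
have mG : measurable_fun (`[0%R, +oo[%classic : set (measurableTypeR R)) (EFin \o G).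
  apply/measurable_EFinP.
  rewrite (_ : G = (fun v => if v < th then G1 v else G2 v)); last first.
    by apply/funext => v; case: ltP => [/GG1|/GG2].
  apply: measurable_funTS; apply: measurable_fun_ifT.
  - by apply: measurable_fun_ltr => //; exact: measurable_id.
  - exact: continuous_measurable_fun.
  - exact: continuous_measurable_fun.
have itvU : `[0%R, +oo[%classic = `[0%R, th[%classic `|` `[th, +oo[%classic :> set R.
  by rewrite -itv_bndbnd_setU // bnd_simp.
rewrite itvU ge0_integral_setU //; last 3 first.
- by rewrite -itvU.
- by move=> v; rewrite -itvU /= in_itv /= andbT; exact: G0.
- apply/disj_set2P; apply/seteqP; split => // v /=; rewrite !in_itv /= andbT => -[/andP[_ h1] h2].
  by rewrite ltNge h2 in h1.
rewrite e1 e2 -EFinD; congr EFin.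
rewrite /F1 /F2 mulr0 !mul0r !addr0 mulrN1 subrr /psi cand_psi_th0 //.
(* The contributions of [F1] and [F2] at the meeting time now cancel, and minus [F1] at 0 is the
   claimed value. *)
rewrite adjustment_coefE // -/g /c2 mulr0 expR0.
rewrite (_ : - (lam + s + g * p2) * th = - (lam + s) * th + - (g * p2) * th); last by ring.
rewrite (_ : - g * (x + th * p1) = - g * (x + p1 * th - p2 * th) + - (g * p2) * th); last by ring.
by rewrite !expRD; field; rewrite gt_eqF.
Qed.

Lemma integral_drop x th M : 0 <= x -> 0 <= th ->
  (forall v, 0 <= v -> 0 <= (if x < v then 1 else psi (x - v) th) + M) ->
  (\int[leb]_(v in `[0%R, +oo[)
     (((if x < v then 1 else psi (x - v) th) + M) * (mu * expR (- mu * v)))%:E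
   = (phi x th + M)%:E)%E.
Proof.
move=> x0 th0 ge0.
pose G v := ((if x < v then 1 else psi (x - v) th) + M) * (mu * expR (- mu * v)).
pose G1 v := mu * expR (- mu * v) * psi (x + v * -1) (th + v * 0) + M * mu * expR (- mu * v).
(* A primitive up to ruin: along (-1, 0) the first equation cancels the phi terms and leaves mu
   psi. *)
pose F1 v := - 1 * expR (- mu * v) * phi (x + v * -1) (th + v * 0) + - M * expR (- mu * v).
pose G2 v := (1 + M) * mu * expR (- mu * v).
have dphi (v : R) := cand_phi_derive lam0 mu0 p20 p21 s0 x th (-1) 0 v.
have dpsi (v : R) := cand_psi_derive lam0 mu0 p20 p21 s0 x th (-1) 0 v.
have dF1 (v : R) : is_derive v 1 F1 (G1 v).
  apply: is_derive_eq (is_deriveD (is_deriveM (is_derive_expM (-1) (- mu) v) (dphi v)) (is_derive_expM (- M) (- mu) v)) _.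
  by rewrite /G1 /GRing.scale /= /phi /psi; ring.
have cG1 : continuous G1.
  apply: (@continuous_is_derive _ _ _ (fun v => is_deriveD (is_deriveM (is_derive_expM mu (- mu) v) (dpsi v)) (is_derive_expM (M * mu) (- mu) v))).
have cG2 : continuous G2 by exact: continuous_expM.
have GG1 v : v <= x -> G v = G1 v.
  move=> vx; rewrite /G ltNge vx /= /G1 mulrN1 mulr0 addr0; ring.
have GG2 v : x < v -> G v = G2 v.
  by move=> vx; rewrite /G vx /G2; ring.
have G0 v : 0 <= v -> 0 <= G v by move=> v0; rewrite mulr_ge0 ?ge0 //; positivity.
have M1 : 0 <= 1 + M by have := ge0 (x + 1); rewrite ltrDl ltr01; apply; rewrite addr_ge0.
have e2 : (\int[leb]_(v in `]x, +oo[) (G v)%:E = ((1 + M) * expR (- mu * x))%:E)%E.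
  transitivity (\int[leb]_(v in `]x, +oo[) (G2 v)%:E)%E.
    by apply: eq_integral => v; rewrite inE /= in_itv /= andbT => /GG2 ->.
  rewrite integral_itv_obnd_cbnd; last first.
    by apply/measurable_EFinP; apply: measurable_funTS; exact: continuous_measurable_fun.
  rewrite integral_expM_itvcy //; last by positivity.
  by congr EFin; field; rewrite gt_eqF.
have e1 : (\int[leb]_(v in `[0%R, x]) (G v)%:E = (F1 x - F1 0)%:E)%E.
  rewrite -(FTC2_is_derive x0 cG1 dF1).
  by apply: eq_integral => v; rewrite inE /= in_itv /= => /andP[_ /GG1 ->].
have mG : measurable_fun (`[0%R, +oo[%classic : set (measurableTypeR R)) (EFin \o G).
  apply/measurable_EFinP.
  rewrite (_ : G = (fun v => if x < v then G2 v else G1 v)); last first.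
    by apply/funext => v; case: ltP => [/GG2|/GG1].
  apply: measurable_funTS; apply: measurable_fun_ifT.
  - by apply: measurable_fun_ltr => //; exact: measurable_id.
  - exact: continuous_measurable_fun.
  - exact: continuous_measurable_fun.
have itvU : `[0%R, +oo[%classic = `[0%R, x]%classic `|` `]x, +oo[%classic :> set R.
  by rewrite -itv_bndbnd_setU // bnd_simp.
rewrite itvU ge0_integral_setU //; last 3 first.
- by rewrite -itvU.
- by move=> v; rewrite -itvU /= in_itv /= andbT; exact: G0.
- apply/disj_set2P; apply/seteqP; split => // v /=; rewrite !in_itv /= andbT => -[/andP[_ h1] h2].
  by rewrite ltNge h1 in h2.
rewrite e1 e2 -EFinD; congr EFin.
(* At v = x the boundary condition phi = 1 makes [F1] cancel the mass (1 + M) e^{-mu x} of the drops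
   that ruin. *)
rewrite /F1 !mulr0 !mul0r !addr0 mulrN1 subrr /phi cand_phi0 expR0.
ring.
Qed.

End HalfStepIdentities.

(** * The process killed at ruin *)

Section KilledProcess.
Context {R : realType}.
Variables (lam mu p1 p2 s : R).
Hypotheses (lam0 : 0 < lam) (mu0 : 0 < mu) (p20 : 0 < p2) (p21 : p2 < p1)
  (s0 : 0 <= s) (net_profit : lam < mu * p2).
Variables (x1 x2 : R).
Hypothesis x12 : x1 <= x2.

Let g := adjustment_rate lam mu p2 s.
Let psi := cand_psi lam mu p1 p2 s.
Let phi := cand_phi lam mu p1 p2 s.
Let leb := @lebesgue_measure R.
Let q0 : 0 < p1 - p2. Proof. by rewrite subr_gt0. Qed.

Definition meeting_time := (x2 - x1) / (p1 - p2).

Let meeting_time_ge0 : 0 <= meeting_time.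
Proof. by rewrite divr_ge0 ?subr_ge0 // ltW. Qed.

Let meeting_timeE : x2 = x1 + (p1 - p2) * meeting_time.
Proof. by rewrite mulrC divfK ?gt_eqF // addrC subrK. Qed.

(* A state (e, (t, y)) records the elapsed time t and the claims y paid so far;
   e is a mark that never changes.  The state is frozen as soon as the level
   is negative.  The absolute values in [half_step] keep t nonnegative on every
   path, including the null set where an exponential variable is negative. *)
Definition state : Type := (R * (R * R))%type.

(** Both companies, rescaled, pay the same claims, so one of them is ruined exactly when the claims
    exceed the lower line. *)
Definition level (z : state) : R :=
  Num.min (x1 + p1 * z.2.1) (x2 + p2 * z.2.1) - z.2.2.

(** Truncated at 0 because the second line stays the lower one after the meeting, where the problem
    is one-dimensional. *)
Definition gap (z : state) : R := Num.max 0 (meeting_time - z.2.1).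

Definition half_step (up : bool) (zv : state * R) : state :=
  let z := zv.1 in
  if level z < 0 then z
  else if up then (z.1, (z.2.1 + `|zv.2|, z.2.2))
  else (z.1, (z.2.1, z.2.2 + `|zv.2|)).

Lemma half_step_frozen up z v : level z < 0 -> half_step up (z, v) = z.
Proof. by move=> l0; rewrite /half_step l0. Qed.

(** [up] is the direction of the half step about to start: psi precedes a climb, phi a drop. A
    ruined state keeps its discounted payoff. *)
Definition potential (up : bool) (z : state) : R :=
  expR (- s * z.2.1) *
    (if level z < 0 then 1 else if up then psi (level z) (gap z) else phi (level z) (gap z)).

Definition half_rate (up : bool) := if up then lam else mu.

Definition potential_bound := 1 + expR (cand_growth lam mu p1 p2 s * meeting_time).

Let mfst2 : measurable_fun setT (fun z : state => z.2.1).
Proof. by apply: measurableT_comp => //; exact: measurable_snd. Qed.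

Let msnd2 : measurable_fun setT (fun z : state => z.2.2).
Proof. by apply: measurableT_comp => //; exact: measurable_snd. Qed.

Lemma measurable_level : measurable_fun setT level.
Proof.
apply: measurable_funB => //; apply: measurable_minr.
- by apply: measurable_funD => //; exact: measurable_funM.
- by apply: measurable_funD => //; exact: measurable_funM.
Qed.

Lemma measurable_gap : measurable_fun setT gap.
Proof. by apply: measurable_maxr => //; exact: measurable_funB. Qed.

Let measurable_ruined : measurable_fun setT (fun z : state => level z < 0).
Proof. by apply: measurable_fun_ltr => //; exact: measurable_level. Qed.

Lemma measurable_half_step up : measurable_fun setT (half_step up).
Proof.
have m1 : measurable_fun setT (fun zv : state * R => zv.1) by exact: measurable_fst.
have mz1 : measurable_fun setT (fun zv : state * R => zv.1.1).
  by apply: measurableT_comp => //; exact: measurable_fst.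
have mt : measurable_fun setT (fun zv : state * R => zv.1.2.1) by exact: measurableT_comp mfst2 m1.
have my : measurable_fun setT (fun zv : state * R => zv.1.2.2) by exact: measurableT_comp msnd2 m1.
have mv : measurable_fun setT (fun zv : state * R => `|zv.2|).
  by apply: measurableT_comp => //; exact: measurable_snd.
apply: measurable_fun_ifT => //; first exact: (measurableT_comp measurable_ruined m1).
case: up.
- apply: measurable_fun_pair => //; apply: measurable_fun_pair => //.
  exact: measurable_funD.
- apply: measurable_fun_pair => //; apply: measurable_fun_pair => //.
  exact: measurable_funD.
Qed.

Lemma measurable_potential up : measurable_fun setT (potential up).
Proof.
apply: measurable_funM.
  by apply: measurableT_comp => //; exact: measurable_funM.
apply: measurable_fun_ifT => //.
case: up.
- apply: (measurable_cand_psi lam0 mu0 p20 p21 s0) => //; [exact: measurable_level|exact: measurable_gap].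
- apply: (measurable_cand_phi lam0 mu0 p20 p21 s0) => //; [exact: measurable_level|exact: measurable_gap].
Qed.

Let growth0 : 0 <= cand_growth lam mu p1 p2 s.
Proof. exact: cand_growth_ge0. Qed.

Let g0 : 0 < g. Proof. exact: adjustment_rate_gt0. Qed.

Lemma gap_ge0 z : 0 <= gap z.
Proof. by rewrite /gap le_max lexx. Qed.

Let gap_le z : 0 <= z.2.1 -> gap z <= meeting_time.
Proof. by move=> t0; rewrite /gap ge_max meeting_time_ge0 gerBl. Qed.

Lemma potential_alive_le up z : 0 <= z.2.1 -> 0 <= level z ->
  `|potential up z| <= potential_bound * (expR (- s * z.2.1) * expR (- g * level z)).
Proof.
move=> t0 l0; rewrite /potential ltNge l0 /= normrM ger0_norm ?expR_ge0 // mulrCA.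
apply: ler_wpM2l; first exact: expR_ge0.
apply: (@le_trans _ _ (expR (cand_growth lam mu p1 p2 s * gap z) * expR (- g * level z))).
  case: up; first exact: (cand_psi_le lam0 mu0 p20 p21 s0 net_profit l0 (gap_ge0 z)).
  exact: (cand_phi_le lam0 mu0 p20 p21 s0 l0 (gap_ge0 z)).
apply: ler_wpM2r; first exact: expR_ge0.
rewrite /potential_bound ler_wpDl // ler_expR ler_wpM2l // gap_le //.
Qed.

Let expRN_le1 (a b : R) : 0 <= a -> 0 <= b -> expR (- a * b) <= 1.
Proof. by move=> a0 b0; rewrite -expR0 ler_expR mulNr oppr_le0 mulr_ge0. Qed.

Lemma potential_le up z : 0 <= z.2.1 -> `|potential up z| <= potential_bound.
Proof.
move=> t0; have [l0|l0] := ltP (level z) 0.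
  rewrite /potential l0 mulr1 ger0_norm ?expR_ge0 //.
  by apply: le_trans (expRN_le1 s0 t0) _; rewrite /potential_bound lerDl expR_ge0.
apply: le_trans (potential_alive_le up t0 l0) _; rewrite -[X in _ <= X]mulr1.
apply: ler_wpM2l; first by rewrite /potential_bound addr_ge0 ?expR_ge0.
have := expRN_le1 s0 t0; have := expRN_le1 (ltW g0) l0 => e1 e2.
by rewrite -[X in _ <= X]mulr1; apply: ler_pM => //; exact: expR_ge0.
Qed.

Let potential_climb z v : 0 <= level z -> 0 <= v ->
  potential false (half_step true (z, v)) =
  expR (- s * z.2.1) * (expR (- s * v) * climb_phi lam mu p1 p2 s (level z) (gap z) v).
Proof.
case: z => e [t y] l0 v0; rewrite /half_step /= ltNge l0 /= (ger0_norm v0).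
have pv0 : 0 <= p2 * v by rewrite mulr_ge0 // ltW.
have pv1 : 0 <= p1 * v by rewrite mulr_ge0 // ltW // (lt_trans p20).
have l1 : 0 <= level (e, (t + v, y)).
  apply: le_trans l0 _; rewrite /level /= lerD2r le_min !ge_min; apply/andP; split.
    by apply/orP; left; rewrite mulrDr addrA lerDl.
  by apply/orP; right; rewrite mulrDr addrA lerDl.
rewrite /potential ltNge l1 /= mulrA -expRD -mulrDr; congr (_ * _).
have minE u : Num.min (x1 + p1 * u) (x2 + p2 * u) =
    if u <= meeting_time then x1 + p1 * u else x2 + p2 * u.
  have E : x2 + p2 * u - (x1 + p1 * u) = (p1 - p2) * (meeting_time - u).
    by rewrite {1}meeting_timeE; ring.
  case: leP => h.
    by apply/min_idPl; rewrite -subr_ge0 E pmulr_rge0 // subr_ge0.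
  by apply/min_idPr; rewrite -subr_le0 E pmulr_rle0 // subr_le0 ltW.
rewrite /climb_phi /level /gap /= !minE -/phi.
have maxl w : meeting_time <= w -> Num.max 0 (meeting_time - w) = 0.
  by move=> mw; apply/max_idPl; rewrite subr_le0.
have maxr w : w <= meeting_time -> Num.max 0 (meeting_time - w) = meeting_time - w.
  by move=> mw; apply/max_idPr; rewrite subr_ge0.
have [tm|tm] := leP t meeting_time; last first.
  have tvm : meeting_time < t + v by rewrite (lt_le_trans tm) // lerDl.
  rewrite !maxl ?(ltW tm) ?(ltW tvm) // (ltNge v) v0 /= (leNgt (t + v)) tvm /=.
  by congr phi; ring.
rewrite (maxr t) // ltrBrDl.
have [tvm|tvm] := ltP (t + v) meeting_time.
  by rewrite (ltW tvm) maxr ?(ltW tvm) //; congr phi; ring.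
rewrite maxl //.
(* If the climb ends exactly at the meeting, [minE] selects the first line and [climb_phi] its
   second branch; the two values agree there. *)
have [tvm'|_] := leP (t + v) meeting_time.
  have -> : t + v = meeting_time by apply/le_anti; rewrite tvm tvm'.
  have -> : v = meeting_time - t by apply/le_anti; rewrite lerBrDl tvm' lerBlDl tvm.
  by congr phi; ring.
by congr phi; rewrite [in LHS]meeting_timeE; ring.
Qed.

Let potential_drop z v : 0 <= level z -> 0 <= v ->
  potential true (half_step false (z, v)) =
  expR (- s * z.2.1) * (if level z < v then 1 else psi (level z - v) (gap z)).
Proof.
case: z => e [t y] l0 v0; rewrite /half_step /= ltNge l0 /= (ger0_norm v0).
have lE : level (e, (t, y + v)) = level (e, (t, y)) - v by rewrite /level /= opprD addrA.
by rewrite /potential lE subr_lt0.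
Qed.

Lemma integral_potential up z M : 0 <= z.2.1 -> potential_bound <= M ->
  (\int[leb]_(v in `[0%R, +oo[)
     ((potential (~~ up) (half_step up (z, v)) + M)
       * (half_rate up * expR (- half_rate up * v)))%:E
   = (potential up z + M)%:E)%E.
Proof.
move=> t0 MB.
have r0 : 0 < half_rate up by rewrite /half_rate; case: up.
have P0 b z' : 0 <= z'.2.1 -> 0 <= potential b z' + M.
  move=> t'0; have := potential_le b t'0; rewrite ler_norml => /andP[h _].
  by rewrite -lerBlDr sub0r; apply: le_trans h; rewrite lerN2.
have [l0|l0] := ltP (level z) 0.
  have e b : potential b z = expR (- s * z.2.1) by rewrite /potential l0 mulr1.
  under eq_integral => v _ do rewrite /half_step l0 e mulrA.
  rewrite integral_expM_itvcy ?e //; last first.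
    by apply: mulr_ge0; [rewrite -(e true); exact: P0|exact: ltW].
  by rewrite mulr0 expR0 mulr1 mulfK ?gt_eqF.
have hs0 v : 0 <= v -> 0 <= (half_step up (z, v)).2.1.
  by move=> v0; rewrite /half_step ltNge l0 /=; case: (up) => //=; rewrite addr_ge0.
set E := expR (- s * z.2.1).
have E0 : 0 < E by exact: expR_gt0.
(* The discount already accumulated leaves the integral, so the undiscounted identities are used
   with the shift M / E. *)
have EM : E * (M / E) = M by rewrite mulrC divfK ?gt_eqF.
transitivity (E%:E * ((if up then psi (level z) (gap z) else phi (level z) (gap z)) + M / E)%:E)%E; last first.
  by rewrite -EFinM mulrDr EM /potential ltNge l0 /= -/E.
have mI : measurable_fun setT (fun v : R => (E^-1 * potential (~~ up) (half_step up (z, v)) + M / E)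
    * (half_rate up * expR (- half_rate up * v))).
  apply: measurable_funM; last by apply: measurable_funM => //; apply: measurableT_comp => //; exact: measurable_funM.
  apply: measurable_funD => //; apply: measurable_funM => //.
  apply: (measurableT_comp (measurable_potential (~~ up))).
  apply: (measurableT_comp (measurable_half_step up)).
  exact: measurable_fun_pair.
have main (f : R -> R) (A : R) : (forall v, 0 <= v -> potential (~~ up) (half_step up (z, v)) = E * f v) ->
  ((forall v, 0 <= v -> 0 <= f v + M / E) ->
    (\int[leb]_(v in `[0%R, +oo[) ((f v + M / E) * (half_rate up * expR (- half_rate up * v)))%:E = (A + M / E)%:E)%E) ->
  (\int[leb]_(v in `[0%R, +oo[)
     ((potential (~~ up) (half_step up (z, v)) + M)
       * (half_rate up * expR (- half_rate up * v)))%:E = E%:E * (A + M / E)%:E)%E.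
  move=> fE fI.
  have f0 v : 0 <= v -> 0 <= f v + M / E.
    move=> v0; rewrite -(pmulr_rge0 _ E0) mulrDr EM -fE //; apply: P0; exact: hs0.
  rewrite -(fI f0) -ge0_integralZl_EFin //.
  - apply: eq_integral => v; rewrite inE /= in_itv /= andbT => v0.
    by rewrite fE // -EFinM; congr EFin; rewrite -{1}EM; ring.
  - by move=> v; rewrite /= in_itv /= andbT => v0; rewrite lee_fin mulr_ge0 ?f0 //; positivity.
  - apply: (eq_measurable_fun (fun v => ((E^-1 * potential (~~ up) (half_step up (z, v)) + M / E)
        * (half_rate up * expR (- half_rate up * v)))%:E)).
      by move=> v; rewrite inE /= in_itv /= andbT => v0; rewrite fE // mulKf // gt_eqF.
    by apply/measurable_EFinP; apply: measurable_funTS; exact: mI.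
  - exact: ltW.
case: up hs0 P0 r0 mI main => hs0 P0 r0 mI main.
- apply: (main _ _ (fun v v0 => potential_climb l0 v0)) => ge0.
  exact: (integral_climb lam0 mu0 p20 p21 s0 net_profit l0 (gap_ge0 z) ge0).
- apply: (main _ _ (fun v v0 => potential_drop l0 v0)) => ge0.
  exact: (integral_drop lam0 mu0 p20 p21 s0 l0 (gap_ge0 z) ge0).
Qed.

(* With a decay rate strictly between 0 and g, the weight [survival] dominates
   the potential of solvent states while one climb followed by one drop contracts
   it in mean, so the contribution of the paths still solvent after n half steps
   tends to 0. *)
Definition survival_rate := g / 2.
Let beta := survival_rate.

Let beta0 : 0 < beta. Proof. by rewrite divr_gt0. Qed.

Let beta_lt : beta < mu.
Proof.
have := adjustment_rate_lt lam0 mu0 p20 s0; rewrite -/g => gm.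
by apply: le_lt_trans gm; rewrite /beta /survival_rate ler_pdivrMr // ler_pMr // ler1n.
Qed.

(** The line x1 + p2 t lies below both lines, so it may replace the level in an upper bound; being a
    single line, it makes each half step multiply the weight by an exponential in v, with no case
    distinction at the meeting. *)
Definition survival (z : state) : R :=
  if level z < 0 then 0 else expR (- s * z.2.1) * expR (- beta * (x1 + p2 * z.2.1 - z.2.2)).

(** The means of e^{-(s + beta p2) v} over a climb and of e^{beta v} over a drop; the latter is
    finite because beta < mu. *)
Definition survival_factor (up : bool) : R :=
  if up then lam / (lam + s + beta * p2) else mu / (mu - beta).

Definition ruin_payoff (z : state) : R := if level z < 0 then expR (- s * z.2.1) else 0.

Lemma survival_factor_ge0 up : 0 <= survival_factor up.
Proof.
have d0 : 0 < lam + s by rewrite ltr_wpDr.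
by rewrite /survival_factor; case: up; [positivity|rewrite divr_ge0 ?subr_ge0 // ltW].
Qed.

Lemma survival_factor_lt1 : survival_factor true * survival_factor false < 1.
Proof. exact: half_adjustment_rate_contraction. Qed.

Lemma survival_ge0 z : 0 <= survival z.
Proof. by rewrite /survival; case: ifP => // _; positivity. Qed.

Lemma ruin_payoff_ge0 z : 0 <= ruin_payoff z.
Proof. by rewrite /ruin_payoff; case: ifP => // _; positivity. Qed.

Lemma measurable_survival : measurable_fun setT survival.
Proof.
apply: measurable_fun_ifT => //; apply: measurable_funM.
  by apply: measurableT_comp => //; exact: measurable_funM.
apply: measurableT_comp => //; apply: measurable_funM => //.
by apply: measurable_funB => //; apply: measurable_funD => //; exact: measurable_funM.
Qed.

Lemma measurable_ruin_payoff : measurable_fun setT ruin_payoff.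
Proof.
apply: measurable_fun_ifT => //; apply: measurableT_comp => //.
exact: measurable_funM.
Qed.

Lemma potential_near_payoff up z : 0 <= z.2.1 ->
  `|potential up z - ruin_payoff z| <= potential_bound * survival z.
Proof.
move=> t0; have [l0|l0] := ltP (level z) 0.
  by rewrite /potential /ruin_payoff /survival l0 mulr1 subrr normr0 mulr0.
rewrite /ruin_payoff ltNge l0 /= subr0.
apply: le_trans (potential_alive_le up t0 l0) _; apply: ler_wpM2l.
  by rewrite /potential_bound addr_ge0 ?expR_ge0.
rewrite /survival ltNge l0 /=; apply: ler_wpM2l; first exact: expR_ge0.
rewrite ler_expR !mulNr lerN2; apply: (@le_trans _ _ (beta * level z)).
  apply: ler_wpM2l; first exact: ltW.
  rewrite /level lerD2r le_min; apply/andP; split; last by rewrite lerD2r.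
  by rewrite lerD2l ler_wpM2r // ltW.
by apply: ler_wpM2r => //; rewrite ler_pdivrMr // ler_peMr ?ltW // ltr1n.
Qed.

(** Only an inequality, because the paths ruined during this half step lose their weight. *)
Lemma integral_survival up z : 0 <= z.2.1 ->
  (\int[leb]_(v in `[0%R, +oo[)
     (survival (half_step up (z, v)) * (half_rate up * expR (- half_rate up * v)))%:E
   <= (survival_factor up * survival z)%:E)%E.
Proof.
move=> t0.
have [l0|l0] := ltP (level z) 0.
  rewrite integral0_eq ?lee_fin ?mulr_ge0 ?survival_factor_ge0 ?survival_ge0 // => v _.
  by rewrite /half_step l0 /survival l0 mul0r.
have d0 : 0 < lam + s by rewrite ltr_wpDr.
pose k := if up then - (s + beta * p2) else beta.
have k0 : 0 < half_rate up - k.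
  rewrite /k /half_rate; case: (up); last by rewrite subr_gt0.
  by rewrite opprK addrA; positivity.
have r0 : 0 < half_rate up by rewrite /half_rate; case: (up).
have le v : 0 <= v -> survival (half_step up (z, v)) <= survival z * expR (k * v).
  move=> v0; rewrite {2}/survival (ltNge (level z)) l0 /=.
  have E : expR (- s * (half_step up (z, v)).2.1) * expR (- beta * (x1 + p2 * (half_step up (z, v)).2.1 - (half_step up (z, v)).2.2))
      = expR (- s * z.2.1) * expR (- beta * (x1 + p2 * z.2.1 - z.2.2)) * expR (k * v).
    rewrite /half_step (ltNge (level z)) l0 /= (ger0_norm v0) /k -!expRD; congr expR.
    by case: (up) => /=; ring.
  rewrite -E /survival; case: ifP => // _; positivity.
have mS : measurable_fun setT (fun v : R => survival (half_step up (z, v))).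
  apply: (measurableT_comp measurable_survival).
  by apply: (measurableT_comp (measurable_half_step up)); exact: measurable_fun_pair.
apply: (@le_trans _ _ (\int[leb]_(v in `[0%R, +oo[) ((survival z * half_rate up) * expR (- (half_rate up - k) * v))%:E)%E).
  apply: ge0_le_integral => //.
  - by move=> v _; rewrite lee_fin mulr_ge0 ?survival_ge0 //; positivity.
  - apply/measurable_EFinP; apply: measurable_funTS; apply: measurable_funM; first exact: mS.
    by apply: measurable_funM => //; apply: measurableT_comp => //; exact: measurable_funM.
  - apply/measurable_EFinP; apply: measurable_funTS; apply: measurable_funM => //.
    by apply: measurableT_comp => //; exact: measurable_funM.
  - move=> v; rewrite /= in_itv /= andbT => v0; rewrite lee_fin.
    rewrite (_ : - (half_rate up - k) * v = k * v + - half_rate up * v); last by ring.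
    rewrite expRD (_ : survival z * half_rate up * _ = survival z * expR (k * v) * (half_rate up * expR (- half_rate up * v))); last by ring.
    by apply: ler_wpM2r; [positivity|exact: le].
have := survival_ge0 z => sz.
rewrite integral_expM_itvcy //; last by rewrite mulr_ge0 // ltW.
rewrite mulr0 expR0 mulr1 lee_fin le_eqVlt; apply/orP; left; apply/eqP.
rewrite [RHS]mulrC -mulrA; congr (_ * _); rewrite /survival_factor /half_rate /k.
by case: (up) => //; rewrite opprK addrA.
Qed.

End KilledProcess.

(** * Integrands not known to be measurable *)

Section NonMeasurableIntegrand.
Context d (T : measurableType d) (R : realType) (m : {measure set T -> \bar R}).
Local Open Scope ereal_scope.

(* The integral of a nonnegative function is a supremum over the simple
   functions below it, so monotonicity needs no measurability. *)
Lemma le_integral_ge0 (f g : T -> \bar R) : (forall x, 0 <= f x) ->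
  (forall x, f x <= g x) -> \int[m]_x f x <= \int[m]_x g x.
Proof.
move=> f0 fg; have g0 x : 0 <= g x by exact: le_trans (fg x).
rewrite !ge0_integralTE //; apply: le_ereal_sup => _ [h hf <-].
by exists h => // x; exact: le_trans (fg x).
Qed.

(** f lies between the two functions equal to g off N and to 0, respectively +oo, on N. Both are
    measurable and have the integral of g. *)
Lemma integral_eq_off_null (N : set T) (f g : T -> \bar R) :
  measurable N -> m N = 0 -> measurable_fun setT g ->
  (forall x, 0 <= f x) -> (forall x, 0 <= g x) ->
  (forall x, ~ N x -> f x = g x) -> \int[m]_x f x = \int[m]_x g x.
Proof.
move=> mN N0 mg f0 g0 fg.
have mCN : measurable_fun setT (fun x => x \in N).
  apply: (measurable_fun_bool true) => //; rewrite setTI (_ : _ @^-1` _ = N) //.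
  by apply/seteqP; split => x /= h; [exact: set_mem|exact: mem_set].
have mif c : measurable_fun setT (fun x => if x \in N then c else g x).
  by apply: measurable_fun_ifT.
have Iif c : 0 <= c -> \int[m]_x (if x \in N then c else g x) = \int[m]_x g x.
  move=> c0; apply: ge0_ae_eq_integral => //.
  - by move=> x _; case: ifP.
  - by exists N; split => // x /= /not_implyP[_]; case: ifPn; rewrite ?inE.
apply/eqP; rewrite eq_le; apply/andP; split.
  rewrite -(Iif +oo) ?leey //; apply: le_integral_ge0 => // x.
  by case: ifPn => [_|]; rewrite ?leey // notin_setE => /fg ->.
rewrite -(Iif 0) //; apply: le_integral_ge0 => x; first by case: ifP.
by case: ifPn => [_|]; rewrite ?f0 // notin_setE => /fg ->.
Qed.

End NonMeasurableIntegrand.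

(** * Mean payoff of the killed chain *)

Section KilledChain.
Context d (T : measurableType d) (R : realType) (P : probability T R).
Variables (lam mu p1 p2 s : R).
Hypotheses (lam0 : 0 < lam) (mu0 : 0 < mu) (p20 : 0 < p2) (p21 : p2 < p1)
  (s0 : 0 <= s) (net_profit : lam < mu * p2).
Variables (x1 x2 : R).
Hypothesis x12 : x1 <= x2.
Variables (xi : nat -> {RV P >-> R}) (Y : {RV P >-> R}) (b : bool).
Let up n := odd n (+) b.
Hypothesis law : forall n, has_exponential_law (half_rate lam mu (up n)) (xi n).
Hypothesis indepY : forall C (J : seq nat) B, measurable C -> uniq J ->
  (forall i, measurable (B i)) ->
  P (Y @^-1` C `&` \bigcap_(i in [set` J]) (xi i @^-1` B i)) =
  (P (Y @^-1` C) * \prod_(i <- J) P (xi i @^-1` B i))%E.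

Let start (w : T) : @state R := (Y w, (0, 0)).

Let measurable_start : measurable_fun setT start.
Proof. by apply: measurable_fun_pair => //; exact: measurable_funPT. Qed.

(** The initial value Y is carried as the mark, so that restriction to an event on Y is a function
    of the state and passes through the one-step identities. The case b = true starts with a climb,
    as psi does; b = false starts with a drop, as phi does. *)
Definition killed_chain :=
  chain xi (fun n => half_step p1 p2 x1 x2 (odd n (+) b)) (fun w => (Y w, (0, 0))).

Let Z n : T -> @state R := killed_chain n.

Let ZS n w : Z n.+1 w = half_step p1 p2 x1 x2 (up n) (Z n w, xi n w).
Proof. by []. Qed.

Let Z_mark n w : (Z n w).1 = Y w.
Proof. by elim: n => // n IH; rewrite ZS /half_step; case: ifP => //; case: ifP. Qed.

Let Z_time n w : 0 <= (Z n w).2.1.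
Proof.
elim: n => [|n IH]; first exact: lexx.
by rewrite ZS /half_step; case: ifP => //; case: ifP => //= _ _; rewrite addr_ge0.
Qed.

Let mstep n : measurable_fun setT (half_step p1 p2 x1 x2 (up n)).
Proof. exact: measurable_half_step. Qed.

Let measurable_Z n : measurable_fun setT (Z n).
Proof. exact: (measurable_chain xi mstep measurable_start). Qed.

Let Z_step n (h : @state R -> \bar R) : measurable_fun setT h -> (forall z, 0 <= h z)%E ->
  (\int[P]_w h (Z n.+1 w) =
   \int[P]_w \int[lebesgue_measure]_(v in `[0%R, +oo[)
     (h (half_step p1 p2 x1 x2 (up n) (Z n w, v)) *
       (half_rate lam mu (up n) * expR (- half_rate lam mu (up n) * v))%:E))%E.
Proof.
move=> mh h0; rewrite (@chain_step _ _ _ _ _ _ xi _ start mstep measurable_start) //.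
  apply: eq_integral => w _; apply: ge0_integral_exponential_law => //.
  - by rewrite /half_rate; case: ifP.
  - apply: (measurableT_comp mh); apply: (measurableT_comp (mstep n)).
    exact: measurable_fun_pair.
move=> C J B mC uJ mB; rewrite /= (_ : start @^-1` C = Y @^-1` [set y | C (y, (0, 0))]) //.
apply: indepY => //.
have mp : measurable_fun setT (fun y : R => (y, ((0 : R), (0 : R)))) by exact: measurable_fun_pair.
by rewrite -[X in measurable X]setTI; exact: (mp measurableT _ mC).
Qed.

Let measurable_Z_step n (h : @state R -> \bar R) : measurable_fun setT h -> (forall z, 0 <= h z)%E ->
  measurable_fun setT (fun w => \int[lebesgue_measure]_(v in `[0%R, +oo[)
     (h (half_step p1 p2 x1 x2 (up n) (Z n w, v)) *
       (half_rate lam mu (up n) * expR (- half_rate lam mu (up n) * v))%:E))%E.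
Proof.
move=> mh h0.
have := @measurable_chain_step _ _ _ _ _ _ xi _ start mstep measurable_start n h mh h0.
apply: eq_measurable_fun => w _; apply: ge0_integral_exponential_law => //.
- by rewrite /half_rate; case: ifP.
- apply: (measurableT_comp mh); apply: (measurableT_comp (mstep n)).
  exact: measurable_fun_pair.
Qed.

Variable A : set R.
Hypothesis mA : measurable A.

Let pot n := potential lam mu p1 p2 s x1 x2 (up n).
Let Mb := potential_bound lam mu p1 p2 s x1 x2.
Let surv := survival lam mu p1 p2 s x1 x2.
Let fac := survival_factor lam mu p2 s.
Let payoff := ruin_payoff p1 p2 s x1 x2.
Let mark : @state R -> R := fun z => \1_A z.1.

Let mark_ge0 z : 0 <= mark z. Proof. by rewrite /mark indicE. Qed.

Let mmark : measurable_fun setT mark.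
Proof. by apply: measurableT_comp; [exact: measurable_indic|exact: measurable_fst]. Qed.

Let upS n : up n.+1 = ~~ up n.
Proof. by rewrite /up /= addNb. Qed.

Let pot_ge0 n z : 0 <= z.2.1 -> 0 <= pot n z + Mb.
Proof.
move=> t0; have := potential_le lam0 mu0 p20 p21 s0 net_profit x12 (up n) t0.
by rewrite ler_norml => /andP[h _]; rewrite -lerBlDr sub0r.
Qed.

Let mark_step n w v : mark (half_step p1 p2 x1 x2 (up n) (Z n w, v)) = mark (Z n w).
Proof. by rewrite /mark /half_step; case: ifP => //; case: ifP. Qed.

Let step_time n w v : 0 <= (half_step p1 p2 x1 x2 (up n) (Z n w, v)).2.1.
Proof.
have t0 := Z_time n w.
by rewrite /half_step; case: ifP => //; case: ifP => //= _ _; rewrite addr_ge0.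
Qed.

Let potential_bound_ge0 : 0 <= Mb.
Proof. by rewrite /Mb /potential_bound addr_ge0 ?expR_ge0. Qed.

Let potential_start w : pot 0 (Z 0 w) = potential lam mu p1 p2 s x1 x2 b (0, (0, 0)).
Proof. by []. Qed.

#[local] Opaque killed_chain potential potential_bound half_step survival.

Let expect_potential n :
  (\int[P]_w (mark (Z n w) * (pot n (Z n w) + Mb))%:E =
   \int[P]_w (mark (Z 0 w) * (pot 0 (Z 0 w) + Mb))%:E)%E.
Proof.
elim: n => [//|n IH]; rewrite -IH.
(* [Z_step] wants nonnegativity at every state, including those of negative time; at the states the
   chain visits the absolute value changes nothing. *)
pose h z := (mark z * `|pot n.+1 z + Mb|)%:E.
have mh : measurable_fun setT h.
  apply/measurable_EFinP; apply: (measurable_funM mmark).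
  apply: measurableT_comp; first by [].
  apply: measurable_funD; last by [].
  exact: measurable_potential.
have h0 z : (0 <= h z)%E by rewrite lee_fin mulr_ge0.
transitivity (\int[P]_w h (Z n.+1 w))%E.
  by apply: eq_integral => w _; rewrite /h ger0_norm // pot_ge0.
rewrite (Z_step n mh h0); apply: eq_integral => w _.
have t0 := Z_time n w.
have r0 : 0 < half_rate lam mu (up n) by rewrite /half_rate; case: ifP.
rewrite EFinM -(integral_potential lam0 mu0 p20 p21 s0 net_profit x12 (up n) t0 (lexx _)).
rewrite -ge0_integralZl_EFin //.
- apply: eq_integral => v _; rewrite /h mark_step ger0_norm; last by rewrite pot_ge0.
  by rewrite -!EFinM -[in LHS]mulrA /pot upS.
- move=> v _; rewrite lee_fin; apply: mulr_ge0.
    by have := pot_ge0 n.+1 (step_time n w v); rewrite /pot upS.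
  by apply: mulr_ge0; [exact: ltW|exact: expR_ge0].
- apply/measurable_EFinP; apply: measurable_funTS; apply: measurable_funM; last first.
    by apply: measurable_funM => //; apply: measurableT_comp => //; exact: measurable_funM.
  apply: measurable_funD => //.
  apply: (measurableT_comp (measurable_potential lam0 mu0 p20 p21 s0 _ _ _)).
  by apply: (measurableT_comp (mstep n)); exact: measurable_fun_pair.
Qed.

#[local] Transparent killed_chain potential potential_bound half_step survival.

Let surv0 w : surv (Z 0 w) <= expR (- survival_rate lam mu p2 s * x1).
Proof.
rewrite /surv /survival /= !mulr0 expR0 mul1r addr0 subr0.
by case: ifP => _; rewrite ?expR_ge0.
Qed.

#[local] Opaque killed_chain potential potential_bound half_step survival.

Let expect_survival n :
  (\int[P]_w (mark (Z n w) * surv (Z n w))%:E <=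
   (\prod_(k < n) fac (up k) * expR (- survival_rate lam mu p2 s * x1))%:E)%E.
Proof.
have fac_ge0 c : 0 <= fac c by exact: survival_factor_ge0.
have surv_ge0 z : 0 <= surv z by exact: survival_ge0.
have msurv : measurable_fun setT surv by exact: measurable_survival.
elim: n => [|n IH].
  apply: (@le_trans _ _ (\int[P]_w (expR (- survival_rate lam mu p2 s * x1))%:E)%E).
    apply: ge0_le_integral => //.
    - by move=> w _; rewrite lee_fin mulr_ge0.
    - apply/measurable_EFinP; apply: measurable_funM.
        exact: (measurableT_comp mmark (measurable_Z 0)).
      exact: (measurableT_comp msurv (measurable_Z 0)).
    - move=> w _; rewrite lee_fin; apply: le_trans (surv0 w).
      by rewrite ler_piMl // /mark indicE lern1 leq_b1.
  rewrite integral_cst //; set pT := (X in (_ * X <= _)%E).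
  by rewrite (_ : pT = 1%E) ?mule1 ?big_ord0 ?mul1r //; exact: probability_setT.
pose h z := (mark z * surv z)%:E.
have mh : measurable_fun setT h by apply/measurable_EFinP; exact: measurable_funM.
have h0 z : (0 <= h z)%E by rewrite lee_fin mulr_ge0.
rewrite (Z_step n mh h0).
have mmZ : measurable_fun setT (fun w => mark (Z n w)) by exact: (measurableT_comp mmark (measurable_Z n)).
have msZ : measurable_fun setT (fun w => surv (Z n w)) by exact: (measurableT_comp msurv (measurable_Z n)).
apply: (@le_trans _ _ (\int[P]_w ((fac (up n))%:E * (mark (Z n w) * surv (Z n w))%:E))%E); last first.
  rewrite ge0_integralZl_EFin //.
  - rewrite big_ord_recr /= mulrAC EFinM muleC.
    by apply: lee_wpmul2r; rewrite ?lee_fin.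
  - by move=> w _; rewrite lee_fin mulr_ge0.
  - by apply/measurable_EFinP; exact: measurable_funM.
have r0 : 0 < half_rate lam mu (up n) by rewrite /half_rate; case: ifP.
have mfin (w : T) : measurable_fun (`[0%R, +oo[%classic : set (measurableTypeR R))
    (fun v => (surv (half_step p1 p2 x1 x2 (up n) (Z n w, v)) *
       (half_rate lam mu (up n) * expR (- half_rate lam mu (up n) * v)))%:E).
  apply/measurable_EFinP; apply: measurable_funTS; apply: measurable_funM; last first.
    by apply: measurable_funM => //; apply: measurableT_comp => //; exact: measurable_funM.
  apply: (measurableT_comp msurv).
  by apply: (measurableT_comp (mstep n)); exact: measurable_fun_pair.
have inner w : (\int[lebesgue_measure]_(v in `[0%R, +oo[)
     (h (half_step p1 p2 x1 x2 (up n) (Z n w, v)) *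
       (half_rate lam mu (up n) * expR (- half_rate lam mu (up n) * v))%:E) <=
   (fac (up n))%:E * (mark (Z n w) * surv (Z n w))%:E)%E.
  under eq_integral => v _ do rewrite /h mark_step -EFinM -mulrA EFinM.
  rewrite ge0_integralZl_EFin //; last first.
    by move=> v _; rewrite lee_fin mulr_ge0 //; positivity.
  rewrite -EFinM mulrCA EFinM; apply: lee_wpmul2l; first by rewrite lee_fin.
  exact: integral_survival.
apply: ge0_le_integral => //.
- move=> w _; apply: integral_ge0 => v _; rewrite mule_ge0 // lee_fin; positivity.
- exact: measurable_Z_step.
- by apply/measurable_EFinP; apply: measurable_funM => //; exact: measurable_funM.
Qed.

(** The factor of a drop alone exceeds 1, so the chain is observed after even numbers of half steps,
    where climbs and drops come in pairs for either value of b. *)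
Let prod_fac n : \prod_(k < n.*2) fac (up k) = (fac true * fac false) ^+ n.
Proof.
elim: n => [|n IH]; first by rewrite big_ord0.
rewrite doubleS !big_ord_recr /= IH exprSr -mulrA; congr (_ * _).
rewrite /up /= odd_double addFb addTb.
by case: b => //=; rewrite mulrC.
Qed.

Let payoff_ge0 z : 0 <= payoff z. Proof. exact: ruin_payoff_ge0. Qed.

Let payoff_nd w : {homo (fun n => payoff (Z n w)) : n m / (n <= m)%N >-> n <= m}.
Proof.
apply/nondecreasing_seqP => n; rewrite ZS; set z := Z n w.
have [l0|l0] := ltP (level p1 p2 x1 x2 z) 0; first by rewrite half_step_frozen.
by rewrite {1}/payoff /ruin_payoff ltNge l0 /=; exact: payoff_ge0.
Qed.

Let Yprob : (\int[P]_w (\1_A (Y w))%:E)%E = P (Y @^-1` A).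
Proof.
have mYA : measurable (Y @^-1` A) by rewrite -[X in measurable X]setTI; exact: measurable_funPT.
by rewrite -(setIT (Y @^-1` A)) -integral_indic.
Qed.

Let mG n : measurable_fun setT (fun w => payoff (Z n w)).
Proof.
have mp : measurable_fun setT payoff by exact: measurable_ruin_payoff.
exact: (measurableT_comp mp (measurable_Z n)).
Qed.

Let mA1 : measurable_fun setT (fun w => \1_A (Y w) : R).
Proof. by apply: measurableT_comp; [exact: measurable_indic|exact: measurable_funPT]. Qed.

Let ge0A w : 0 <= \1_A (Y w) :> R. Proof. by rewrite indicE. Qed.

Let cvg_expect_payoff :
  (\int[P]_w (\1_A (Y w) * payoff (Z n.*2 w))%:E)%E @[n --> \oo] -->
  (P (Y @^-1` A) * (potential lam mu p1 p2 s x1 x2 b (0, (0, 0)))%:E)%E.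
Proof.
have mYA : measurable (Y @^-1` A) by rewrite -[X in measurable X]setTI; exact: measurable_funPT.
pose p := fine (P (Y @^-1` A)).
have pE : P (Y @^-1` A) = p%:E by rewrite fineK // fin_num_measure.
have p0 : 0 <= p by exact: fine_ge0.
have Mb0 : 0 <= Mb by rewrite /Mb potential_bound_ge0.
pose pot0 := potential lam mu p1 p2 s x1 x2 b (0, (0, 0)).
have pot0E w : pot 0 (Z 0 w) = pot0 by exact: potential_start.
pose c n := (fac true * fac false) ^+ n * expR (- survival_rate lam mu p2 s * x1).
pose a n := (\int[P]_w (\1_A (Y w) * payoff (Z n.*2 w))%:E)%E.
have surv_ge0 z : 0 <= surv z by exact: survival_ge0.
have mS n : measurable_fun setT (fun w => surv (Z n w)).
  have ms : measurable_fun setT surv by exact: measurable_survival.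
  exact: (measurableT_comp ms (measurable_Z n)).
have mPt n : measurable_fun setT (fun w => pot n (Z n w)).
  have mp : measurable_fun setT (pot n) by exact: measurable_potential.
  exact: (measurableT_comp mp (measurable_Z n)).
have IK : (\int[P]_w (\1_A (Y w) * Mb)%:E = (p * Mb)%:E)%E.
  under eq_integral => w _ do rewrite EFinM.
  by rewrite ge0_integralZr // ?Yprob ?pE //; exact/measurable_EFinP.
have IF n : (\int[P]_w (\1_A (Y w) * (pot n.*2 (Z n.*2 w) + Mb))%:E = (p * (pot0 + Mb))%:E)%E.
  have := expect_potential n.*2; rewrite /mark.
  under eq_integral => w _ do rewrite Z_mark.
  move=> ->; under eq_integral => w _ do rewrite Z_mark pot0E EFinM.
  rewrite ge0_integralZr // ?Yprob ?pE //; first exact/measurable_EFinP.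
  exact: (@pot_ge0 0 (0, (0, 0)) (lexx 0)).
have IS n : (\int[P]_w (\1_A (Y w) * surv (Z n.*2 w))%:E <= (c n)%:E)%E.
  have := expect_survival n.*2; rewrite /mark prod_fac.
  by under eq_integral => w _ do rewrite Z_mark.
have mGn n : measurable_fun setT (fun w => (\1_A (Y w) * payoff (Z n.*2 w))%:E).
  by apply/measurable_EFinP; exact: measurable_funM.
have mSn n : measurable_fun setT (fun w => (\1_A (Y w) * surv (Z n.*2 w))%:E).
  by apply/measurable_EFinP; exact: measurable_funM.
have mFn n : measurable_fun setT (fun w => (\1_A (Y w) * (pot n.*2 (Z n.*2 w) + Mb))%:E).
  apply/measurable_EFinP; apply: (measurable_funM mA1).
  by apply: (measurable_funD (mPt _)).
have mK : measurable_fun setT (fun w => (\1_A (Y w) * Mb)%:E).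
  by apply/measurable_EFinP; exact: measurable_funM.
have G0 n w : (0 <= (\1_A (Y w) * payoff (Z n.*2 w))%:E)%E by rewrite lee_fin mulr_ge0.
have S0 n w : (0 <= (\1_A (Y w) * surv (Z n.*2 w))%:E)%E by rewrite lee_fin mulr_ge0.
have F0 n w : (0 <= (\1_A (Y w) * (pot n.*2 (Z n.*2 w) + Mb))%:E)%E.
  by rewrite lee_fin mulr_ge0 // pot_ge0.
have K0 w : (0 <= (\1_A (Y w) * Mb)%:E)%E by rewrite lee_fin mulr_ge0.
have near n w : `|pot n.*2 (Z n.*2 w) - payoff (Z n.*2 w)| <= Mb * surv (Z n.*2 w).
  exact: potential_near_payoff.
have split n (f : T -> \bar R) : measurable_fun setT f -> (forall w, 0 <= f w)%E ->
  (\int[P]_w (f w + (\1_A (Y w) * Mb)%:E + Mb%:E * (\1_A (Y w) * surv (Z n.*2 w))%:E) <=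
   \int[P]_w f w + (p * Mb)%:E + (Mb * c n)%:E)%E.
  move=> mf f0; have MS0 w : (0 <= Mb%:E * (\1_A (Y w) * surv (Z n.*2 w))%:E)%E.
    by apply: mule_ge0; [rewrite lee_fin|exact: S0].
  rewrite ge0_integralD //; last 3 first.
  - by move=> w _; rewrite adde_ge0.
  - exact: emeasurable_funD.
  - by apply: emeasurable_funM.
  rewrite ge0_integralD // IK leeD2l //.
  by rewrite ge0_integralZl_EFin // EFinM lee_wpmul2l ?lee_fin.
(* The potential differs from the payoff by at most Mb times the survival weight. [le1] and [le2]
   state this in mean with sums on both sides, which avoids subtracting extended integrals. *)
have le1 n : ((p * (pot0 + Mb))%:E <= a n + (p * Mb)%:E + (Mb * c n)%:E)%E.
  rewrite -(IF n); apply: le_trans (split n _ (mGn n) (G0 n)).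
  apply: ge0_le_integral => //.
  - by apply: emeasurable_funD; [exact: emeasurable_funD|exact: emeasurable_funM].
  - move=> w _; rewrite -EFinM -!EFinD lee_fin.
    have := near n w; rewrite ler_norml => /andP[_ h].
    rewrite [X in _ <= X](_ : _ = \1_A (Y w) * (payoff (Z n.*2 w) + Mb * surv (Z n.*2 w) + Mb)); last by ring.
    by apply: ler_wpM2l => //; rewrite lerD2r -lerBlDl.
have le2 n : (a n + (p * Mb)%:E <= (p * (pot0 + Mb))%:E + (Mb * c n)%:E)%E.
  apply: (@le_trans _ _ (\int[P]_w ((\1_A (Y w) * (pot n.*2 (Z n.*2 w) + Mb))%:E + Mb%:E * (\1_A (Y w) * surv (Z n.*2 w))%:E))%E).
    rewrite -IK -ge0_integralD //; apply: ge0_le_integral => //.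
    - by move=> w _; rewrite adde_ge0.
    - exact: emeasurable_funD.
    - by apply: emeasurable_funD => //; exact: emeasurable_funM.
    - move=> w _; rewrite -EFinM -!EFinD lee_fin.
      have := near n w; rewrite ler_norml => /andP[h _].
      rewrite [X in _ <= X](_ : _ = \1_A (Y w) * (pot n.*2 (Z n.*2 w) + Mb * surv (Z n.*2 w) + Mb)); last by ring.
      rewrite -mulrDr; apply: ler_wpM2l => //; rewrite lerD2r.
      by move: h; rewrite lerBrDr [- _ + _]addrC lerBlDr.
  rewrite ge0_integralD //; last 2 first.
  - by move=> w _; apply: mule_ge0; [rewrite lee_fin|exact: S0].
  - exact: emeasurable_funM.
  by rewrite IF leeD2l // ge0_integralZl_EFin // EFinM lee_wpmul2l ?lee_fin.
have a0 n : (0 <= a n)%E by apply: integral_ge0.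
have afin n : (fine (a n))%:E = a n.
  rewrite fineK // ge0_fin_numE //.
  apply: le_lt_trans (lt_le_trans _ (leey _)); last first.
    exact: (ltry (p * (pot0 + Mb) + Mb * c n)).
  rewrite EFinD; apply: le_trans (le2 n); rewrite leeDl // lee_fin mulr_ge0 //.
have c0 : Mb * c n @[n --> \oo] --> 0.
  rewrite -[X in _ --> X](mulr0 Mb); apply: cvgMr.
  rewrite -[X in _ --> X](mul0r (expR (- survival_rate lam mu p2 s * x1))); apply: cvgMl.
  apply: cvg_expr; rewrite ger0_norm; first exact: survival_factor_lt1.
  by apply: mulr_ge0; exact: survival_factor_ge0.
have close n : `|p * pot0 - fine (a n)| <= Mb * c n.
  rewrite ler_norml.
  have := le1 n; have := le2 n; rewrite -(afin n) /= -!EFinD !lee_fin (mulrDr p pot0) => h2 h1.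
  move: (Mb * c n) (fine (a n)) (p * Mb) (p * pot0) h1 h2 => X1 X2 X3 X4 h1 h2.
  by apply/andP; split; lra.
have ac : fine (a n) @[n --> \oo] --> p * pot0.
  apply/cvgrPdist_le => e e0.
  move/cvgrPdist_le: c0 => /(_ e e0); apply: filterS => n; rewrite sub0r normrN => h.
  exact: le_trans (close n) (le_trans (ler_norm _) h).
rewrite pE -EFinM (_ : (fun n => _) = (fun n => (fine (a n))%:E)); last by apply/funext => n; rewrite afin.
by apply: cvg_EFin; [exact: nearW|exact: ac].
Qed.

Lemma integral_ruin_payoff (V : T -> R) :
  (forall w, payoff (Z n.*2 w) @[n --> \oo] --> V w) ->
  (\int[P]_w (\1_A (Y w) * V w)%:E =
   P (Y @^-1` A) * (potential lam mu p1 p2 s x1 x2 b (0, (0, 0)))%:E)%E.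
Proof.
move=> cvgV; pose h n w := (\1_A (Y w) * payoff (Z n.*2 w))%:E.
have hV w : h n w @[n --> \oo] --> (\1_A (Y w) * V w)%:E.
  by apply: cvg_EFin; [exact: nearW|apply: cvgMr; exact: cvgV].
have mh n : measurable_fun setT (h n) by apply/measurable_EFinP; exact: measurable_funM.
have h0 n w : (0 <= h n w)%E by rewrite lee_fin mulr_ge0.
have hnd w : {homo (h ^~ w) : n m / (n <= m)%N >-> (n <= m)%E}.
  by move=> n m nm; rewrite lee_fin ler_wpM2l // payoff_nd // leq_double.
transitivity (limn (fun n => \int[P]_w h n w))%E; last first.
  apply/cvg_lim => //; exact: cvg_expect_payoff.
rewrite -monotone_convergence //.
by apply: eq_integral => w _; apply/esym/cvg_lim.
Qed.

Let payoff_le1 n w : payoff (Z n w) <= 1.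
Proof.
rewrite /payoff /ruin_payoff; case: ifP => // _.
by rewrite -expR0 ler_expR mulNr oppr_le0 mulr_ge0.
Qed.

Let is_cvg_payoff w : cvgn (fun n => payoff (Z n.*2 w)).
Proof.
apply: nondecreasing_is_cvgn.
  by move=> n m nm; apply: payoff_nd; rewrite leq_double.
by exists 1 => _ [n _ <-]; exact: payoff_le1.
Qed.

(* f need not be measurable, since P is not assumed to be complete. *)
Lemma integral_ruin_ae (f : T -> R) (N : set T) : measurable N -> P N = 0%E ->
  (forall w, 0 <= f w) ->
  (forall w, ~ N w -> \1_A (Y w) * payoff (Z n.*2 w) @[n --> \oo] --> f w) ->
  (\int[P]_w (f w)%:E =
   P (Y @^-1` A) * (potential lam mu p1 p2 s x1 x2 b (0, (0, 0)))%:E)%E.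
Proof.
move=> mN N0 f0 cvgf.
pose V w := limn (fun n => payoff (Z n.*2 w)).
rewrite -(@integral_ruin_payoff V) //.
have V0 w : 0 <= V w by apply: limr_ge => //; apply: nearW.
have mV : measurable_fun setT V.
  by apply: (@measurable_fun_cvg _ _ _ setT (fun n w => payoff (Z n.*2 w))) => // w _; exact: is_cvg_payoff.
apply: (@integral_eq_off_null _ _ _ P N) => //.
- by apply/measurable_EFinP; exact: measurable_funM.
- by move=> w; rewrite lee_fin mulr_ge0.
move=> w Nw; congr EFin; apply: (cvg_unique _ (cvgf w Nw)) => //.
by apply: cvgMr; exact: is_cvg_payoff.
Qed.

End KilledChain.

(** * Sample paths *)

Section Epochs.
Context {R : realType}.
Variable x : nat -> R.
Hypotheses (x_ge0 : forall k, 0 <= x k)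
  (x_unbounded : forall t, exists n, t < partial_sum x n).

Lemma partial_sumS n : partial_sum x n.+1 = partial_sum x n + x n.
Proof. by rewrite /partial_sum big_ord_recr. Qed.

Lemma partial_sum0 : partial_sum x 0 = 0.
Proof. by rewrite /partial_sum big_ord0. Qed.

Lemma partial_sum_nd : {homo partial_sum x : n m / (n <= m)%N >-> n <= m}.
Proof. by apply/nondecreasing_seqP => n; rewrite partial_sumS lerDl. Qed.

Lemma partial_sum_ge0 n : 0 <= partial_sum x n.
Proof. by rewrite -partial_sum0 partial_sum_nd. Qed.

Lemma epoch_index t : 0 <= t -> exists n, partial_sum x n <= t < partial_sum x n.+1.
Proof.
move=> t0; have ex : exists n, t < partial_sum x n by exact: x_unbounded.
case: (ex_minnP ex) => -[|n]; first by rewrite partial_sum0 ltNge t0.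
move=> tn mn; exists n; rewrite tn andbT leNgt; apply/negP => /mn.
by rewrite ltnn.
Qed.

Lemma count_epochsE n t : partial_sum x n <= t < partial_sum x n.+1 ->
  count_epochs (partial_sum x) t = n.
Proof.
move=> /andP[nt tn]; rewrite /count_epochs.
have -> : [set m : nat | (0 < m)%N /\ partial_sum x m <= t] = [set` [fset i in iota 1 n]%fset].
  apply/seteqP; split => m /=; rewrite !inE mem_iota add1n ltnS.
    move=> [m0 mt]; rewrite m0 /= leqNgt; apply/negP => nm.
    by have := lt_le_trans tn (partial_sum_nd nm); rewrite ltNge mt.
  by move=> /andP[m0 mn]; split => //; apply: le_trans nt; exact: partial_sum_nd.
rewrite set_fsetK card_fseq undup_id ?size_iota //; exact: iota_uniq.
Qed.

End Epochs.

(** * Up time of a fluid path starting downwards *)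

Section Fluid.
Context {R : realType}.
Variables tau sigma : nat -> R.
Hypotheses (tau_ge0 : forall k, 0 <= tau k) (sigma_ge0 : forall k, 0 <= sigma k)
  (tau_unbounded : forall t, exists n, t < partial_sum tau n).

Let period := fluid_period (-1) tau sigma.
Let epoch := partial_sum period.

Let periodE k : period k = if odd k then tau k./2 else sigma k./2.
Proof. by rewrite /period /fluid_period (_ : (-1 == 1 :> R) = false) // lt_eqF // -subr_gt0 opprK addr_gt0. Qed.

Let period_ge0 k : 0 <= period k.
Proof. by rewrite periodE; case: ifP. Qed.

Lemma fluid_epoch_even n :
  fluid_epoch (-1) tau sigma n.*2 = partial_sum sigma n + partial_sum tau n.
Proof.
rewrite /fluid_epoch -/period; elim: n => [|n IH]; first by rewrite !partial_sum0 addr0.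
rewrite doubleS !partial_sumS IH !periodE /= odd_double /= uphalf_double doubleK; ring.
Qed.

Lemma fluid_epoch_odd n :
  fluid_epoch (-1) tau sigma n.*2.+1 = partial_sum sigma n.+1 + partial_sum tau n.
Proof.
have := fluid_epoch_even n; rewrite /fluid_epoch -/period !partial_sumS => ->.
by rewrite periodE odd_double doubleK addrAC.
Qed.

Let epoch_unbounded t : exists n, t < epoch n.
Proof.
have [n tn] := tau_unbounded t; exists n.*2; apply: lt_le_trans tn _.
by have := fluid_epoch_even n; rewrite /fluid_epoch -/period -/epoch => ->; rewrite lerDr partial_sum_ge0.
Qed.

Lemma fluid_index t : 0 <= t ->
  exists m, fluid_epoch (-1) tau sigma m <= t < fluid_epoch (-1) tau sigma m.+1.
Proof. by move=> t0; exact: epoch_index. Qed.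

Let f (v : R) : R := \1_[set v | fluid_sign (-1) tau sigma v = 1] v.

Let fE m v : epoch m <= v < epoch m.+1 -> f v = (odd m)%:R.
Proof.
move=> mv; rewrite /f indicE; congr (_%:R : R); congr nat_of_bool.
have c : fluid_sign (-1) tau sigma v = - (-1) ^+ m.
  by rewrite /fluid_sign /fluid_epoch -/period (count_epochsE period_ge0 mv) mulN1r.
apply/idP/idP.
  rewrite inE /= c -signr_odd; case: (odd m) => //; rewrite expr0 => h.
  by move: (@ltrN10 R); rewrite h ltr10.
by move=> om; rewrite inE /= c -signr_odd om expr1 opprK.
Qed.

Let leb := @lebesgue_measure R.

Let piece m t : epoch m <= t -> t <= epoch m.+1 ->
  measurable_fun (`[epoch m, t[%classic : set (measurableTypeR R)) (EFin \o f) /\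
  (\int[leb]_(v in `[epoch m, t[) (f v)%:E = ((odd m)%:R * (t - epoch m))%:E)%E.
Proof.
move=> mt tm.
have fc v : v \in (`[epoch m, t[%classic : set R) -> (EFin \o f) v = ((odd m)%:R : R)%:E.
  by rewrite inE /= in_itv /= => /andP[h1 h2]; rewrite (@fE m) // h1 (lt_le_trans h2).
split.
  by apply: (eq_measurable_fun (cst ((odd m)%:R : R)%:E)) => // v vi; rewrite fc.
rewrite (eq_integral (cst ((odd m)%:R : R)%:E)) ; last by move=> v; exact: fc.
rewrite integral_cst //= lebesgue_measure_itv /= lte_fin.
case: ltP => h; first by rewrite -EFinB -EFinM.
have -> : t = epoch m by apply/le_anti; rewrite h mt.
by rewrite subrr mulr0 mule0.
Qed.

(** The up time at epoch m: the path starts with a drop, so m./2 climbs are complete by then. *)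
Let half_tau m := partial_sum tau m./2.

Let f_ge0 v : 0 <= f v. Proof. by rewrite /f indicE. Qed.

Let glue a m t : epoch m <= t -> t <= epoch m.+1 ->
  measurable_fun (`[0%R, epoch m[%classic : set (measurableTypeR R)) (EFin \o f) ->
  (\int[leb]_(v in `[0%R, epoch m[) (f v)%:E = a%:E)%E ->
  measurable_fun (`[0%R, t[%classic : set (measurableTypeR R)) (EFin \o f) /\
  (\int[leb]_(v in `[0%R, t[) (f v)%:E = (a + (odd m)%:R * (t - epoch m))%:E)%E.
Proof.
move=> mt tm mf If; have [mp Ip] := piece mt tm.
have U : `[0%R, t[%classic = `[0%R, epoch m[%classic `|` `[epoch m, t[%classic :> set R.
  by rewrite -itv_bndbnd_setU // bnd_simp partial_sum_ge0.
have mU : measurable_fun (`[0%R, t[%classic : set (measurableTypeR R)) (EFin \o f).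
  by rewrite U; apply/measurable_funU.
split => //; rewrite U ge0_integral_setU //; last 3 first.
- by rewrite -U.
- by move=> v _; rewrite lee_fin.
- apply/disj_set2P; apply/seteqP; split => // v /=; rewrite !in_itv /= => -[/andP[_ h1] /andP[h2 _]].
  by rewrite ltNge h2 in h1.
by rewrite [X in (X + _)%E]If [X in (_ + X)%E]Ip EFinD.
Qed.

Let integral_epoch m :
  measurable_fun (`[0%R, epoch m[%classic : set (measurableTypeR R)) (EFin \o f) /\
  (\int[leb]_(v in `[0%R, epoch m[) (f v)%:E = (half_tau m)%:E)%E.
Proof.
elim: m => [|m [mf If]].
  rewrite /epoch partial_sum0 set_itvco0; split; first exact: measurable_fun_set0.
  by rewrite integral_set0 /half_tau partial_sum0.
have mm : epoch m <= epoch m.+1 by exact: partial_sum_nd.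
have [mf' If'] := glue mm (lexx _) mf If; split => //.
rewrite [LHS]If'; congr EFin; rewrite /epoch partial_sumS addrAC subrr add0r periodE.
rewrite /half_tau /= uphalf_half.
by case: (odd m); rewrite ?mul1r ?mul0r ?addr0 // add1n partial_sumS.
Qed.

Lemma up_timeE m t :
  fluid_epoch (-1) tau sigma m <= t < fluid_epoch (-1) tau sigma m.+1 ->
  up_time (-1) tau sigma t =
    partial_sum tau m./2 + (odd m)%:R * (t - fluid_epoch (-1) tau sigma m).
Proof.
rewrite /fluid_epoch -/period -/epoch => /andP[mt tm].
have [mf If] := integral_epoch m.
have [mf' If'] := glue mt (ltW tm) mf If.
rewrite /up_time /Rintegral.
rewrite -[X in fine X](@integral_itv_bndo_bndc _ _ _ (EFin \o f)) //.
by rewrite [X in fine X]If'.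
Qed.

End Fluid.

(** * Ruin times read at the claims *)

Section RuinPaths.
Context {R : realType}.
Variables tau sigma : nat -> R.
Hypotheses (tau_ge0 : forall k, 0 <= tau k) (sigma_ge0 : forall k, 0 <= sigma k)
  (tau_unbounded : forall t, exists n, t < partial_sum tau n).
Variables (c1 c2 delta1 delta2 u1 u2 : R).
Hypotheses (delta1_gt0 : 0 < delta1) (delta2_gt0 : 0 < delta2)
  (c1_gt0 : 0 < c1) (c2_gt0 : 0 < c2) (u1_ge0 : 0 <= u1) (u2_ge0 : 0 <= u2).

Let Tn := partial_sum tau.
Let Sn := partial_sum sigma.

Definition barrier (t : R) : R :=
  Num.min (u1 / delta1 + c1 / delta1 * t) (u2 / delta2 + c2 / delta2 * t).

Let barrier_lt a y : (barrier a < y) = (u1 + c1 * a - delta1 * y < 0) || (u2 + c2 * a - delta2 * y < 0).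
Proof.
have E c dl u : 0 < dl -> (u / dl + c / dl * a < y) = (u + c * a - dl * y < 0).
  move=> d0; rewrite -(ltr_pM2l d0) subr_lt0; congr (_ < _).
  by field; rewrite gt_eqF.
by rewrite /barrier gt_min !E.
Qed.

Lemma barrier_nd : {homo barrier : a t / a <= t}.
Proof.
move=> a t at_; have h c dl u : 0 < dl -> 0 < c -> u / dl + c / dl * a <= u / dl + c / dl * t.
  by move=> d0 c0; rewrite lerD2l ler_pM2l // divr_gt0.
by rewrite /barrier le_min !ge_min !h //= orbT.
Qed.

Lemma barrier_ge0 t : 0 <= t -> 0 <= barrier t.
Proof. by move=> t0; rewrite /barrier le_min; apply/andP; split; positivity. Qed.

Let Tn_ge0 n : 0 <= Tn n. Proof. exact: partial_sum_ge0. Qed.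
Let Tn_nd := partial_sum_nd tau_ge0.
Let Sn_nd := partial_sum_nd sigma_ge0.

(** The infimum need not be attained: the fluid reserve is exactly 0 at its ruin time and negative
    only just after. Hence points of A are required arbitrarily close to a from the right. *)
Let hitting_time_ge (A : set R) a : 0 <= a -> (forall t, 0 <= t -> A t -> a <= t) ->
  (forall t, a < t -> exists2 r, A r & a <= r <= t) -> hitting_time A = a%:E.
Proof.
move=> a0 lb ub; apply/eqP; rewrite eq_le; apply/andP; split; last first.
  by apply: le_ereal_inf_tmp => _ [t [t0 At] <-]; rewrite lee_fin lb.
apply/lee_addgt0Pr => e e0.
have [|r Ar /andP[ar re]] := ub (a + e); first by rewrite ltrDl.
apply: ge_ereal_inf; exists r%:E; last by rewrite -EFinD lee_fin.
exists r => //; split => //; exact: le_trans ar.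
Qed.

Let hitting_time_infty (A : set R) : (forall t, 0 <= t -> ~ A t) -> hitting_time A = +oo%E.
Proof.
move=> nA; rewrite /hitting_time (_ : [set _ | _ in _] = set0) ?ereal_inf0 //.
by apply/seteqP; split => // y [t [t0 At] _]; exact: (nA t).
Qed.

Let ruin_set t : (reserve tau sigma c1 delta1 u1 t < 0 \/ reserve tau sigma c2 delta2 u2 t < 0) <->
  barrier t < aggregate_claims tau sigma t.
Proof. by rewrite barrier_lt; split => /orP. Qed.

Let aggregateE n t : Tn n <= t < Tn n.+1 -> aggregate_claims tau sigma t = Sn n.
Proof. by move=> nt; rewrite /aggregate_claims /claim_count (count_epochsE tau_ge0 nt). Qed.

(** The barrier rises and the claims are constant between claim epochs, so it suffices to compare
    them at these epochs. *)
Let solvent_before n t : (forall j, (j < n)%N -> Sn j.+1 <= barrier (Tn j.+1)) ->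
  0 <= t -> t < Tn n.+1 -> ~ (barrier t < aggregate_claims tau sigma t).
Proof.
move=> ok t0 tn; have [m mt] := epoch_index tau_unbounded t0.
rewrite (aggregateE mt) => bt; have /andP[mt1 mt2] := mt.
have mn : (m <= n)%N.
  by rewrite leqNgt; apply/negP => /Tn_nd h; have := lt_le_trans tn h; rewrite ltNge mt1.
suff : Sn m <= barrier t by rewrite leNgt bt.
case: m mt mt1 mt2 mn bt => [|m] mt mt1 mt2 mn bt; first by rewrite /Sn partial_sum0 barrier_ge0.
by apply: le_trans (ok _ mn) _; exact: barrier_nd.
Qed.

Lemma ruin_time_infty : (forall j, Sn j.+1 <= barrier (Tn j.+1)) ->
  ruin_time tau sigma c1 c2 delta1 delta2 u1 u2 = +oo%E.
Proof.
move=> ok; apply: hitting_time_infty => t t0 /ruin_set.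
have [n] := tau_unbounded t => tn; apply: (@solvent_before n) => //.
exact: lt_le_trans tn (Tn_nd (leqnSn n)).
Qed.

Lemma ruin_timeE n : (forall j, (j < n)%N -> Sn j.+1 <= barrier (Tn j.+1)) ->
  barrier (Tn n.+1) < Sn n.+1 ->
  ruin_time tau sigma c1 c2 delta1 delta2 u1 u2 = (Tn n.+1)%:E.
Proof.
move=> ok bn; apply: hitting_time_ge => // [t t0 /ruin_set h|t tn].
  by rewrite leNgt; apply/negP => tn; exact: (solvent_before ok t0 tn).
exists (Tn n.+1); last by rewrite lexx ltW.
apply/ruin_set; apply: lt_le_trans bn _.
(* Zero inter-arrival times are allowed here, so several claims may fall at this instant and the
   count m is only at least n+1. *)
have [m mt] := epoch_index tau_unbounded (Tn_ge0 n.+1).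
rewrite (aggregateE mt); apply: Sn_nd.
rewrite ltnNge; apply/negP => mn; have /andP[_] := mt.
by rewrite ltNge => /negP; apply; exact: Tn_nd.
Qed.

Let up := up_time (-1) tau sigma.
Let epoch := fluid_epoch (-1) tau sigma.

(** In the fluid picture the up time is the clock of the risk process and the remaining time t - up
    t is the amount paid. *)
Let fluid_set t : (Num.min (fluid_reserve (-1) tau sigma c1 delta1 u1 t)
   (fluid_reserve (-1) tau sigma c2 delta2 u2 t) < 0) = (barrier (up t) < t - up t).
Proof. by rewrite barrier_lt gt_min. Qed.

Let up_even n t : epoch n.*2 <= t < epoch n.*2.+1 -> up t = Tn n.
Proof.
by move=> nt; rewrite /up (up_timeE tau_ge0 sigma_ge0 nt) odd_double mul0r addr0 doubleK.
Qed.

Let up_odd n t : epoch n.*2.+1 <= t < epoch n.*2.+2 -> up t = t - Sn n.+1.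
Proof.
move=> nt; rewrite /up (up_timeE tau_ge0 sigma_ge0 nt) /= odd_double mul1r uphalf_double.
rewrite fluid_epoch_odd /Sn; ring.
Qed.

(** The path starts with a drop, so the claim of index j comes after j climbs only: the total
    S_{j+1} is compared with the barrier at T_j, not at T_{j+1}. *)
Let fluid_solvent n t : (forall j, (j < n)%N -> Sn j.+1 <= barrier (Tn j)) ->
  0 <= t -> t < epoch n.*2 -> ~ (barrier (up t) < t - up t).
Proof.
move=> ok t0 tn; have [m mt] := fluid_index sigma_ge0 tau_unbounded t0.
have /andP[mt1 mt2] := mt.
have e_nd := @partial_sum_nd _ (fluid_period (-1) tau sigma).
have pge0 k : 0 <= fluid_period (-1) tau sigma k by rewrite /fluid_period; case: ifP.
have mn : (m < n.*2)%N.
  by rewrite ltnNge; apply/negP => /(e_nd pge0) h; have := lt_le_trans tn h; rewrite ltNge mt1.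
have m2n : (m./2 < n)%N by rewrite -ltn_double (leq_ltn_trans _ mn) // -[leqRHS]odd_double_half leq_addl.
have okm := ok _ m2n; apply/negP; rewrite -leNgt; apply: le_trans (le_trans okm _).
  have := odd_double_half m; case: (odd m) => /= mE; rewrite -mE ?add0n ?add1n in mt mt2.
    by rewrite (up_odd mt) opprB addrC subrK.
  rewrite (up_even mt) lerBlDr ltW //; apply: lt_le_trans mt2 _.
  by rewrite /epoch fluid_epoch_odd.
apply: barrier_nd; have := odd_double_half m; case: (odd m) => /= mE; rewrite -mE ?add0n ?add1n in mt mt1.
  rewrite (up_odd mt) lerBrDl; apply: le_trans mt1.
  by rewrite /epoch fluid_epoch_odd.
by rewrite (up_even mt).
Qed.

Lemma fluid_ruin_time_infty : (forall j, Sn j.+1 <= barrier (Tn j)) ->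
  fluid_ruin_time (-1) tau sigma c1 c2 delta1 delta2 u1 u2 = +oo%E.
Proof.
move=> ok; apply: hitting_time_infty => t t0; rewrite /= fluid_set.
have [n] := tau_unbounded t => tn; apply: (@fluid_solvent n) => //.
apply: lt_le_trans tn _; rewrite /epoch fluid_epoch_even lerDr.
exact: partial_sum_ge0.
Qed.

(** During the fatal drop the clock stands still at T_n, and ruin comes when the amount paid reaches
    the barrier there; fluid time is the sum of the two. *)
Lemma fluid_ruin_timeE n : (forall j, (j < n)%N -> Sn j.+1 <= barrier (Tn j)) ->
  barrier (Tn n) < Sn n.+1 ->
  let r := Tn n + barrier (Tn n) in
  fluid_ruin_time (-1) tau sigma c1 c2 delta1 delta2 u1 u2 = r%:E /\
  up_time (-1) tau sigma r = Tn n.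
Proof.
move=> ok bn r.
have Sb : Sn n <= barrier (Tn n).
  case: n ok bn @r => [|n] ok bn r; first by rewrite /Sn partial_sum0 barrier_ge0.
  by apply: le_trans (ok n (ltnSn n)) _; apply: barrier_nd; exact: Tn_nd.
have r1 : epoch n.*2 <= r by rewrite /epoch fluid_epoch_even addrC lerD2l.
have r2 : r < epoch n.*2.+1 by rewrite /epoch fluid_epoch_odd /r addrC ltrD2r.
split; last by apply: up_even; rewrite r1.
have r0 : 0 <= r by rewrite addr_ge0 // barrier_ge0.
apply: hitting_time_ge => // [t t0|t rt]; rewrite /= ?fluid_set.
  move=> bt; rewrite leNgt; apply/negP => tr.
  have [tn|nt] := ltP t (epoch n.*2); first exact: (fluid_solvent ok t0 tn).
  have ut : up t = Tn n by apply: up_even; rewrite nt (lt_trans tr).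
  by move: bt; rewrite ut ltrBrDl ltNge ltW.
(* A time after r and at most t that still belongs to the fatal drop, where the up time is known. *)
pose t' := Num.min t ((r + epoch n.*2.+1) / 2).
have [rt' t't t'e] : [/\ r < t', t' <= t & t' < epoch n.*2.+1].
  rewrite /t' lt_min gt_min ge_min lexx rt /= midf_lt // midf_lt // orbT; split => //.
exists t'; last by rewrite t't ltW.
have ut : up t' = Tn n by apply: up_even; rewrite t'e ltW // (le_lt_trans r1).
by rewrite fluid_set ut ltrBrDl.
Qed.

End RuinPaths.

(** * The killed chain along one path *)

Section ChainPath.
Context d (T : measurableType d) (R : realType) (P : probability T R).
Variables (Y0 : {RV P >-> R}) (tau sigma : nat -> {RV P >-> R}).
Variables (c1 c2 delta1 delta2 u1 u2 s : R).
Hypotheses (delta1_gt0 : 0 < delta1) (delta2_gt0 : 0 < delta2)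
  (c1_gt0 : 0 < c1) (c2_gt0 : 0 < c2) (u1_ge0 : 0 <= u1) (u2_ge0 : 0 <= u2).
Variable b : bool.

Definition half_step_index (n : nat) : option (nat + nat) :=
  Some (if odd n (+) b then inl n./2 else inr n./2).

Definition half_step_length n := source_family Y0 tau sigma (half_step_index n).

Variable w : T.
Hypotheses (tau_ge0 : forall k, 0 <= tau k w) (sigma_ge0 : forall k, 0 <= sigma k w).

Let Tn := partial_sum (tau ^~ w).
Let Sn := partial_sum (sigma ^~ w).
Let bar := barrier c1 c2 delta1 delta2 u1 u2.
Let p1 := c1 / delta1. Let p2 := c2 / delta2.
Let x1 := u1 / delta1. Let x2 := u2 / delta2.
Let Z n := killed_chain p1 p2 x1 x2 half_step_length Y0 b n w.
Let payoff := ruin_payoff p1 p2 s x1 x2.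

Let levelE e t y : level p1 p2 x1 x2 (e, (t, y)) = bar t - y.
Proof. by []. Qed.

Let bar_nd : {homo bar : a t / a <= t}.
Proof. exact: barrier_nd. Qed.

Let Tn_ge0 n : 0 <= Tn n. Proof. exact: partial_sum_ge0. Qed.

(** A climb never ruins, so climb then drop always moves both coordinates. When the drop comes first
    it may ruin, and then the following climb is frozen out and the time stays at t. *)
Let Z_double n t y : Z n.*2 = (Y0 w, (t, y)) -> y <= bar t ->
  Z n.*2.+2 = if b then (Y0 w, (t + tau n w, y + sigma n w))
              else if bar t < y + sigma n w then (Y0 w, (t, y + sigma n w))
              else (Y0 w, (t + tau n w, y + sigma n w)).
Proof.
move=> Zn yt.
have ZS m : Z m.+1 = half_step p1 p2 x1 x2 (odd m (+) b) (Z m, half_step_length m w) by [].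
rewrite !ZS Zn /half_step_length /half_step_index /= odd_double uphalf_double doubleK /=.
have l0 : level p1 p2 x1 x2 (Y0 w, (t, y)) < 0 = false by rewrite levelE subr_lt0 ltNge yt.
case: (b) => /=; rewrite /half_step l0 /= ger0_norm ?tau_ge0 ?sigma_ge0 // levelE subr_lt0.
  rewrite ltNge (le_trans yt) /= ?ger0_norm //.
  by apply: bar_nd; rewrite lerDl.
by case: ifP => // _; rewrite ger0_norm.
Qed.

(** The number of climbs preceding the claim of index j is j + 1 if the path starts with a climb and
    j if it starts with a drop. *)
Let claim_time j := Tn (j + b).

Let Tn_nd : {homo Tn : n m / (n <= m)%N >-> n <= m}. Proof. exact: partial_sum_nd. Qed.

Let solvent n : (forall j, (j < n)%N -> Sn j.+1 <= bar (claim_time j)) -> Sn n <= bar (Tn n).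
Proof.
case: n => [_|n ok]; first by rewrite /Sn /Tn !partial_sum0 barrier_ge0.
apply: le_trans (ok n (ltnSn n)) _; apply: bar_nd; apply: Tn_nd.
by rewrite -addn1 leq_add2l leq_b1.
Qed.

Let Z_solvent n : (forall j, (j < n)%N -> Sn j.+1 <= bar (claim_time j)) ->
  Z n.*2 = (Y0 w, (Tn n, Sn n)).
Proof.
elim: n => [_|n IH ok]; first by rewrite /Sn /Tn !partial_sum0.
have okn j : (j < n)%N -> Sn j.+1 <= bar (claim_time j) by move=> jn; apply: ok; exact: ltnW.
rewrite doubleS (Z_double (IH okn) (solvent okn)) /Tn /Sn !partial_sumS -/(Tn n) -/(Sn n).
have := ok n (ltnSn n); rewrite /Sn partial_sumS -/(Sn n) /claim_time.
by case: (b) => // h; rewrite addn0 in h; rewrite ltNge h.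
Qed.

Let Z_ruined n : (forall j, (j < n)%N -> Sn j.+1 <= bar (claim_time j)) ->
  bar (claim_time n) < Sn n.+1 -> forall k, (n < k)%N ->
  Z k.*2 = (Y0 w, (claim_time n, Sn n.+1)).
Proof.
move=> ok bn k /subnK <-; elim: (k - n.+1)%N => [|j IH].
  rewrite add0n doubleS (Z_double (Z_solvent ok) (solvent ok)).
  move: bn; rewrite /claim_time /Tn /Sn; case: (b); rewrite ?addn1 ?addn0 !partial_sumS //.
  by move=> ->.
rewrite addSn doubleS.
have ZS m : Z m.+1 = half_step p1 p2 x1 x2 (odd m (+) b) (Z m, half_step_length m w) by [].
have l0 : level p1 p2 x1 x2 (Y0 w, (claim_time n, Sn n.+1)) < 0 by rewrite levelE subr_lt0.
by rewrite !ZS IH !half_step_frozen.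
Qed.

Lemma cvg_payoff_solvent : (forall j, Sn j.+1 <= bar (claim_time j)) ->
  payoff (Z n.*2) @[n --> \oo] --> 0.
Proof.
move=> ok; apply: cvg_near_cst; apply: nearW => n.
have okn j : (j < n)%N -> Sn j.+1 <= bar (claim_time j) by move=> _; exact: ok.
by rewrite Z_solvent // /payoff /ruin_payoff levelE subr_lt0 ltNge solvent.
Qed.

Lemma cvg_payoff_ruined n : (forall j, (j < n)%N -> Sn j.+1 <= bar (claim_time j)) ->
  bar (claim_time n) < Sn n.+1 ->
  payoff (Z n.*2) @[n --> \oo] --> expR (- s * claim_time n).
Proof.
move=> ok bn; apply: cvg_near_cst; exists n.+1 => // k /= nk.
by rewrite (Z_ruined ok bn nk) /payoff /ruin_payoff levelE subr_lt0 bn.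
Qed.

End ChainPath.

Section PayoffLimit.
Context d (T : measurableType d) (R : realType) (P : probability T R).
Variables (Y0 : {RV P >-> R}) (tau sigma : nat -> {RV P >-> R}).
Variables (c1 c2 delta1 delta2 u1 u2 s : R).
Hypotheses (delta1_gt0 : 0 < delta1) (delta2_gt0 : 0 < delta2)
  (c1_gt0 : 0 < c1) (c2_gt0 : 0 < c2) (u1_ge0 : 0 <= u1) (u2_ge0 : 0 <= u2).
Variable w : T.
Hypotheses (tau_ge0 : forall k, 0 <= tau k w) (sigma_ge0 : forall k, 0 <= sigma k w)
  (tau_unbounded : forall t, exists n, t < partial_sum (tau ^~ w) n).

Let payoff b n := ruin_payoff (c1 / delta1) (c2 / delta2) s (u1 / delta1) (u2 / delta2)
  (killed_chain (c1 / delta1) (c2 / delta2) (u1 / delta1) (u2 / delta2)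
     (half_step_length Y0 tau sigma b) Y0 b n w).

Let first_ruin b :
  (forall j, partial_sum (sigma ^~ w) j.+1 <=
     barrier c1 c2 delta1 delta2 u1 u2 (partial_sum (tau ^~ w) (j + b))) \/
  exists2 n, forall j, (j < n)%N -> partial_sum (sigma ^~ w) j.+1 <=
     barrier c1 c2 delta1 delta2 u1 u2 (partial_sum (tau ^~ w) (j + b)) &
     barrier c1 c2 delta1 delta2 u1 u2 (partial_sum (tau ^~ w) (n + b)) <
       partial_sum (sigma ^~ w) n.+1.
Proof.
have [ex|nex] := pselect (exists n, barrier c1 c2 delta1 delta2 u1 u2 (partial_sum (tau ^~ w) (n + b)) <
       partial_sum (sigma ^~ w) n.+1).
  right; case: (ex_minnP ex) => n bn mn; exists n => // j jn.
  by rewrite leNgt; apply/negP => /mn; rewrite leqNgt jn.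
by left => j; rewrite leNgt; apply/negP => h; apply: nex; exists j.
Qed.

Lemma cvg_payoff_ruin_time :
  let rt := ruin_time (tau ^~ w) (sigma ^~ w) c1 c2 delta1 delta2 u1 u2 in
  payoff true n.*2 @[n --> \oo] --> if (rt < +oo)%E then expR (- s * fine rt) else 0.
Proof.
have [ok|[n ok bn]] := first_ruin true.
  rewrite ruin_time_infty //= ?ltxx; last by move=> j; have := ok j; rewrite addn1.
  exact: cvg_payoff_solvent.
have ok' j : (j < n)%N -> partial_sum (sigma ^~ w) j.+1 <=
    barrier c1 c2 delta1 delta2 u1 u2 (partial_sum (tau ^~ w) j.+1).
  by move=> jn; have := ok j jn; rewrite addn1.
have bn' := bn; rewrite addn1 in bn'.
rewrite (ruin_timeE tau_ge0 sigma_ge0 tau_unbounded delta1_gt0 delta2_gt0 c1_gt0 c2_gt0 u1_ge0 u2_ge0 ok' bn').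
by rewrite /= ltry -addn1; exact: cvg_payoff_ruined.
Qed.

Lemma cvg_payoff_fluid_ruin_time :
  let rt := fluid_ruin_time (-1) (tau ^~ w) (sigma ^~ w) c1 c2 delta1 delta2 u1 u2 in
  payoff false n.*2 @[n --> \oo] -->
    if (rt < +oo)%E then expR (- s * up_time (-1) (tau ^~ w) (sigma ^~ w) (fine rt)) else 0.
Proof.
have [ok|[n ok bn]] := first_ruin false.
  rewrite fluid_ruin_time_infty //= ?ltxx; last by move=> j; have := ok j; rewrite addn0.
  exact: cvg_payoff_solvent.
have ok' j : (j < n)%N -> partial_sum (sigma ^~ w) j.+1 <=
    barrier c1 c2 delta1 delta2 u1 u2 (partial_sum (tau ^~ w) j).
  by move=> jn; have := ok j jn; rewrite addn0.
have bn' := bn; rewrite addn0 in bn'.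
have [rtE upE] := fluid_ruin_timeE tau_ge0 sigma_ge0 tau_unbounded delta1_gt0 delta2_gt0 c1_gt0 c2_gt0 u1_ge0 u2_ge0 ok' bn'.
rewrite rtE /= ltry upE -(addn0 n).
exact: (@cvg_payoff_ruined _ _ _ _ _ _ _ _ _ _ _ _ _ _ _ _ _ _ _ _ false).
Qed.

End PayoffLimit.

(** * Null sets and independence of the half steps *)

Section AlmostSurePaths.
Context d (T : measurableType d) (R : realType) (P : probability T R).
Variables (Y0 : {RV P >-> R}) (tau sigma : nat -> {RV P >-> R}) (lam mu : R).
Hypotheses (lam_gt0 : 0 < lam)
  (tau_law : forall k, has_exponential_law lam (tau k))
  (sigma_law : forall k, has_exponential_law mu (sigma k))
  (indep : mutually_independent (source_family Y0 tau sigma)).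

Let measurable_preim (X : {RV P >-> R}) (B : set R) : measurable B -> measurable (X @^-1` B).
Proof. by move=> mB; rewrite -[X in measurable X]setTI; exact: measurable_funPT. Qed.

Let short_prob k : P (tau k @^-1` `]-oo, 1[%classic) = (1 - expR (- lam))%:E.
Proof.
have -> : tau k @^-1` `]-oo, 1[%classic = ~` (tau k @^-1` `[1, +oo[%classic).
  apply/seteqP; split => w /=; rewrite !in_itv /= andbT => h; last by rewrite ltNge; apply/negP.
  by apply/negP; rewrite -ltNge.
rewrite probability_setC; last exact: measurable_preim.
rewrite EFinB; congr (_ - _)%E.
have := tau_law k (measurable_itv `[1%R, +oo[); rewrite /distribution /pushforward => ->.
transitivity (lam / lam * expR (- lam * 1))%:E; last by rewrite divff ?gt_eqF // mul1r mulr1.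
rewrite -(integral_expM_itvcy _ (ltW lam_gt0) lam_gt0) /exponential_prob.
apply: eq_integral => x; rewrite inE /= in_itv /= andbT => x1.
by rewrite exponential_pdfE // (le_trans _ x1).
Qed.

Let all_short K := \bigcap_(k in [set k | (K <= k)%N]) (tau k @^-1` `]-oo, 1[%classic).

Let measurable_all_short K : measurable (all_short K).
Proof.
by apply: bigcap_measurable => [|k _]; [exists K => /=|exact: measurable_preim].
Qed.

(** For every m, independence of the m variables from index K on bounds the probability by q^m,
    where q < 1 is the probability of one short waiting time. *)
Let all_short_null K : P (all_short K) = 0%E.
Proof.
pose q := 1 - expR (- lam).
have q0 : 0 <= q by rewrite subr_ge0 -expR0 ler_expR oppr_le0 ltW.
have q1 : q < 1 by rewrite gtrBl expR_gt0.
have le m : (P (all_short K) <= (q ^+ m)%:E)%E.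
  pose J := [seq Some (inl k : nat + nat) | k <- iota K m].
  have uJ : uniq J by rewrite map_inj_uniq ?iota_uniq // => i j [].
  have := indep uJ (fun=> measurable_itv `]-oo, 1%R[).
  rewrite big_map (eq_bigr (fun=> q%:E)) => [|k _]; last exact: short_prob.
  rewrite big_const_seq count_predT size_iota iter_mule mule1 => E.
  rewrite EFin_expe -E; apply: le_measure; rewrite ?inE //.
    apply: fin_bigcap_measurable => [|i _]; first exact: finite_seq.
    exact: measurable_preim.
  move=> w h i /= /mapP[k]; rewrite mem_iota => /andP[Kk _] ->; exact: h.
have Pf : P (all_short K) \is a fin_num by exact: fin_num_measure.
rewrite -(fineK Pf); congr EFin; apply/le_anti; rewrite fine_ge0 // andbT.
have qm : q ^+ m @[m --> \oo] --> 0 by apply: cvg_expr; rewrite ger0_norm.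
rewrite -(cvg_lim _ qm) //; apply: limr_ge; first by apply/cvg_ex; exists 0.
by apply: nearW => m; have := le m; rewrite -(fineK Pf) lee_fin.
Qed.

(* Almost surely tau k >= 1 infinitely often, hence the epochs are unbounded. *)
Lemma null_exceptional_paths : exists N : set T, [/\ measurable N, P N = 0%E &
  forall w, ~ N w -> [/\ forall k, 0 <= tau k w, forall k, 0 <= sigma k w &
    forall t, exists n, t < partial_sum (tau ^~ w) n]].
Proof.
have neg : P.-negligible (\bigcup_k all_short k `|` (\bigcup_k (tau k @^-1` `]-oo, 0[%classic)
    `|` \bigcup_k (sigma k @^-1` `]-oo, 0[%classic))).
  have lt0_null (X : {RV P >-> R}) rate : has_exponential_law rate X ->
      P.-negligible (X @^-1` `]-oo, 0[%classic).
    move=> lawX; exists (X @^-1` `]-oo, 0[%classic); split => //; first exact: measurable_preim.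
    have -> : X @^-1` `]-oo, 0[%classic = [set w | X w < 0].
      by apply/seteqP; split => w /=; rewrite in_itv.
    exact: exponential_law_ge0 lawX.
  apply: negligibleU.
    apply: negligible_bigcup => k; exists (all_short k).
    by split; [exact: measurable_all_short|exact: all_short_null|move=> ?].
  by apply: negligibleU; apply: negligible_bigcup => k; [exact: lt0_null (tau_law k)|exact: lt0_null (sigma_law k)].
case: neg => N [mN N0 subN]; exists N; split => // w Nw.
have nN A : A `<=` N -> ~ A w by move=> AN Aw; exact/Nw/AN.
have tau0 k : 0 <= tau k w.
  by rewrite leNgt; apply/negP => h; apply: Nw; apply: subN; right; left; exists k => //=; rewrite in_itv.
have sigma0 k : 0 <= sigma k w.
  by rewrite leNgt; apply/negP => h; apply: Nw; apply: subN; right; right; exists k => //=; rewrite in_itv.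
split => // t.
have long K : exists2 k, (K <= k)%N & 1 <= tau k w.
  have [//|nex] := pselect (exists2 k, (K <= k)%N & 1 <= tau k w).
  exfalso; apply: Nw; apply: subN; left; exists K => // k /= Kk.
  by rewrite in_itv /= ltNge; apply/negP => h; apply: nex; exists k.
have ge M : exists n, M%:R <= partial_sum (tau ^~ w) n.
  elim: M => [|M [n Mn]]; first by exists 0%N; exact: partial_sum_ge0.
  have [k nk tk] := long n; exists k.+1; rewrite partial_sumS -natr1 lerD //.
  by apply: le_trans Mn _; exact: partial_sum_nd.
have [n hn] := ge (Num.bound `|t|); exists n; apply: lt_le_trans hn.
apply: le_lt_trans (ler_norm t) _; exact: archi_boundP.
Qed.

Lemma half_step_length_indep b (C : set R) (J : seq nat) (B : nat -> set R) :
  measurable C -> uniq J -> (forall i, measurable (B i)) ->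
  P (Y0 @^-1` C `&` \bigcap_(i in [set` J]) (half_step_length Y0 tau sigma b i @^-1` B i)) =
  (P (Y0 @^-1` C) * \prod_(i <- J) P (half_step_length Y0 tau sigma b i @^-1` B i))%E.
Proof.
move=> mC uJ mB.
(* The constraints on half steps are carried back to the sources: climb k is half step 2k + ~~b and
   drop k is half step 2k + b. *)
pose B' (i : option (nat + nat)) : set R := match i with
  | None => C | Some (inl k) => B (k.*2 + ~~ b)%N | Some (inr k) => B (k.*2 + b)%N end.
have B'E n : B' (half_step_index b n) = B n.
  rewrite /half_step_index /= -[in RHS](odd_double_half n) addnC.
  by case: (b); case: (odd n).
have inj : injective (half_step_index b).
  move=> i j; rewrite /half_step_index => -[].
  have := odd_double_half i; have := odd_double_half j.
  by case: (b); case: (odd i); case: (odd j) => //= ej ei -[e]; rewrite -ei -ej e.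
pose J' := None :: [seq half_step_index b n | n <- J].
have uJ' : uniq J'.
  rewrite /= map_inj_uniq // uJ andbT; apply/mapP => -[n _]; by rewrite /half_step_index.
have mB' i : measurable (B' i) by case: i => [[k|k]|] //=.
have := indep uJ' mB'; rewrite big_cons big_map.
rewrite (eq_bigr (fun n => P (half_step_length Y0 tau sigma b n @^-1` B n))) => [<-|n _]; last first.
  by rewrite B'E.
congr (P _); apply/seteqP; split => w /=.
  move=> [Cw h] i; rewrite /= inE => /orP[/eqP -> //|/mapP[n nJ ->]].
  by rewrite B'E; exact: h.
move=> h; split; first by have := h None; rewrite /= inE eqxx; apply.
move=> n /= nJ; rewrite -B'E; apply: (h (half_step_index b n)).
by rewrite /= inE; apply/orP; right; exact: map_f.
Qed.

Lemma half_step_length_law b n :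
  has_exponential_law (half_rate lam mu (odd n (+) b)) (half_step_length Y0 tau sigma b n).
Proof.
rewrite /half_step_length /half_step_index /half_rate /=.
by case: (odd n (+) b).
Qed.

End AlmostSurePaths.

(** * Identification of the ruin transforms *)

Lemma mulr_indic_finite (T : Type) (R : realType) (rt : T -> \bar R) (e : R) (w : T) :
  e * \1_[set w | (rt w < +oo)%E] w = if (rt w < +oo)%E then e else 0.
Proof.
rewrite indicE; case: ifPn => h; first by rewrite mem_set // mulr1.
by rewrite memNset ?mulr0 //; exact/negP.
Qed.

Section TransformFormulas.
Context d (T : measurableType d) (R : realType) (P : probability T R).
Variables (Y0 : {RV P >-> R}) (tau sigma : nat -> {RV P >-> R}).
Variables (c1 c2 delta1 delta2 lam mu s : R).
Hypotheses (delta1_gt0 : 0 < delta1) (delta2_gt0 : 0 < delta2)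
  (c1_gt0 : 0 < c1) (c2_gt0 : 0 < c2)
  (lam_gt0 : 0 < lam) (mu_gt0 : 0 < mu) (s_ge0 : 0 <= s)
  (tau_law : forall k, has_exponential_law lam (tau k))
  (sigma_law : forall k, has_exponential_law mu (sigma k))
  (Y0_neg : (0 < P [set w | (Y0 w = -1)%R])%E)
  (indep : mutually_independent (source_family Y0 tau sigma)).

Let p1 := c1 / delta1.
Let p2 := c2 / delta2.
Hypotheses (p21 : p2 < p1) (net_profit : lam < mu * p2).

Let p2_gt0 : 0 < p2. Proof. exact: divr_gt0. Qed.

(** Shared by both transforms: b = true with A = setT gives psi, b = false with A reduced to -1
    gives the numerator of the conditional expectation phi. *)
Let integral_transform u1 u2 b (A : set R) (f : T -> R) :
  upper_cone delta1 delta2 (u1, u2) -> measurable A ->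
  (forall w, 0 <= f w) ->
  (forall w, (forall k, 0 <= tau k w) -> (forall k, 0 <= sigma k w) ->
    (forall t, exists n, t < partial_sum (tau ^~ w) n) ->
    \1_A (Y0 w) * ruin_payoff p1 p2 s (u1 / delta1) (u2 / delta2)
      (killed_chain p1 p2 (u1 / delta1) (u2 / delta2) (half_step_length Y0 tau sigma b) Y0 b n.*2 w)
    @[n --> \oo] --> f w) ->
  (\int[P]_w (f w)%:E = P (Y0 @^-1` A) *
    ((if b then cand_psi else cand_phi) lam mu p1 p2 s (u1 / delta1)
       ((u2 / delta2 - u1 / delta1) / (p1 - p2)))%:E)%E.
Proof.
move=> [/= u1_ge0 u2_ge0 u12] mA f0 cvgf.
have x10 : 0 <= u1 / delta1 by positivity.
have x12 : u1 / delta1 <= u2 / delta2.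
  by rewrite ler_pdivrMr // mulrAC ler_pdivlMr // mulrC [X in _ <= X]mulrC.
have [N [mN N0 good]] := null_exceptional_paths lam_gt0 tau_law sigma_law indep.
have law n := @half_step_length_law _ _ _ _ Y0 _ _ _ _ tau_law sigma_law b n.
have indepb C J B := @half_step_length_indep _ _ _ _ _ _ _ indep b C J B.
have cvgN w : ~ N w -> \1_A (Y0 w) * ruin_payoff p1 p2 s (u1 / delta1) (u2 / delta2)
      (killed_chain p1 p2 (u1 / delta1) (u2 / delta2) (half_step_length Y0 tau sigma b) Y0 b n.*2 w)
    @[n --> \oo] --> f w by move=> /good[t0 sg0 tu]; exact: cvgf.
rewrite (integral_ruin_ae lam_gt0 mu_gt0 p2_gt0 p21 s_ge0 net_profit x12 law indepb mA mN N0 f0 cvgN).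
congr (_ * _%:E)%E; rewrite /potential /level /gap /= !mulr0 !addr0 expR0 mul1r !subr0.
(* On the cone the first line starts lower, so the initial level is u1 / delta1 and the initial gap
   is the meeting time. *)
rewrite (min_idPl x12) ltNge x10 /= /meeting_time.
rewrite (max_idPr _); first by case: (b).
by rewrite divr_ge0 ?subr_ge0 // ltW.
Qed.

Lemma psiE u1 u2 : upper_cone delta1 delta2 (u1, u2) ->
  psi tau sigma c1 c2 delta1 delta2 u1 u2 s =
  cand_psi lam mu p1 p2 s (u1 / delta1) ((u2 / delta2 - u1 / delta1) / (p1 - p2)).
Proof.
move=> Du; have [u1_ge0 u2_ge0 _] := Du.
pose rt w := ruin_time (tau ^~ w) (sigma ^~ w) c1 c2 delta1 delta2 u1 u2.
pose f w := expR (- s * fine (rt w)) * \1_[set w | (rt w < +oo)%E] w.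
have f0 w : 0 <= f w by rewrite /f indicE mulr_ge0 ?expR_ge0.
have fE w : f w = if (rt w < +oo)%E then expR (- s * fine (rt w)) else 0.
  exact: mulr_indic_finite.
have := @integral_transform _ _ true setT f Du measurableT f0.
rewrite preimage_setT probability_setT mul1e /psi unlock -/f => -> // w t0 sg0 tu.
rewrite fE indicT; under eq_fun do rewrite mul1r.
exact: cvg_payoff_ruin_time.
Qed.

Lemma phiE u1 u2 : upper_cone delta1 delta2 (u1, u2) ->
  phi Y0 tau sigma c1 c2 delta1 delta2 u1 u2 s =
  cand_phi lam mu p1 p2 s (u1 / delta1) ((u2 / delta2 - u1 / delta1) / (p1 - p2)).
Proof.
move=> Du; have [/= u1_ge0 u2_ge0 _] := Du.
pose rt w := fluid_ruin_time (Y0 w) (tau ^~ w) (sigma ^~ w) c1 c2 delta1 delta2 u1 u2.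
pose g w := expR (- s * up_time (Y0 w) (tau ^~ w) (sigma ^~ w) (fine (rt w))) *
  \1_[set w | (rt w < +oo)%E] w.
pose f w := g w * \1_[set w | Y0 w = -1] w.
have f0 w : 0 <= f w.
  by rewrite /f /g; apply: mulr_ge0; [apply: mulr_ge0; [exact: expR_ge0|]|]; rewrite indicE.
have mA : measurable [set (-1 : R)] by exact: measurable_set1.
(* The fluid payoff with the initial sign fixed at -1. It agrees with g where Y0 = -1, and the
   indicator removes the other paths. *)
pose h w := if (fluid_ruin_time (-1) (tau ^~ w) (sigma ^~ w) c1 c2 delta1 delta2 u1 u2 < +oo)%E then
      expR (- s * up_time (-1) (tau ^~ w) (sigma ^~ w)
        (fine (fluid_ruin_time (-1) (tau ^~ w) (sigma ^~ w) c1 c2 delta1 delta2 u1 u2))) else 0.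
have gE w : Y0 w = -1 -> g w = h w by move=> Yw; rewrite /g mulr_indic_finite /rt Yw.
have fE w : f w = \1_[set (-1 : R)] (Y0 w) * h w.
  have markE : \1_[set w | Y0 w = -1] w = \1_[set (-1 : R)] (Y0 w) :> R.
    by rewrite !indicE (_ : (w \in _) = (Y0 w \in [set (-1 : R)])).
  rewrite /f markE mulrC indicE.
  have [Yw|Yw] := pselect (Y0 w = -1); first by rewrite (gE _ Yw).
  by rewrite memNset // !mul0r.
have cf w : (forall k, 0 <= tau k w) -> (forall k, 0 <= sigma k w) ->
    (forall t, exists n, t < partial_sum (tau ^~ w) n) ->
    \1_[set (-1 : R)] (Y0 w) * ruin_payoff p1 p2 s (u1 / delta1) (u2 / delta2)
      (killed_chain p1 p2 (u1 / delta1) (u2 / delta2) (half_step_length Y0 tau sigma false) Y0 false n.*2 w)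
    @[n --> \oo] --> f w.
  by move=> t0 sg0 tu; rewrite fE; apply: cvgMr; exact: cvg_payoff_fluid_ruin_time.
have I := integral_transform Du mA f0 cf.
have mY : measurable [set w | Y0 w = -1].
  by rewrite -[X in measurable X]setTI; exact: (measurable_funPT Y0 measurableT _ mA).
have Pf : P [set w | Y0 w = -1] \is a fin_num by exact: fin_num_measure.
have P0 : fine (P [set w | Y0 w = -1]) != 0 by rewrite gt_eqF // fine_gt0 // Y0_neg ltey_eq Pf.
rewrite /phi /conditional_expectation unlock.
rewrite [X in fine X / _](_ : _ = (\int[P]_w (f w)%:E)%E) // I fineM //.
by rewrite mulrAC divff ?mul1r.
Qed.

End TransformFormulas.

(** The candidate is smooth beyond the cone, so its two-sided derivative restricts to the derivative
    relative to the cone, on the edges as well. *)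
Lemma has_derivative_within_eq (R : realType) (A : set R) (f G : R -> R) (x l : R) :
  A x -> (forall y, A y -> f y = G y) -> is_derive x 1 G l ->
  has_derivative_within A f x l.
Proof.
move=> Ax fG [dG <-].
have cG : h^-1 *: (G (h *: 1 + x) - G x) @[h --> 0^'] --> 'D_1 G x by exact: dG.
have cW : h^-1 *: (G (h *: 1 + x) - G x) @[h --> within [set h | A (x + h)] 0^'] --> 'D_1 G x.
  by apply: cvg_trans cG; apply: cvg_app; exact: cvg_within.
apply: cvg_trans cW; apply: near_eq_cvg; rewrite near_withinE; apply: nearW => h Ah.
by rewrite !fG // [h *: 1](_ : _ = h) ?[x + h]addrC // /GRing.scale /= mulr1.
Qed.

Theorem theorem1 (R : realType) (d : measure_display) (T : measurableType d)
    (P : probability T R)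
    (Y0 : {RV P >-> R}) (tau sigma : nat -> {RV P >-> R})
    (c1 c2 delta1 delta2 lam mu s : R)
    (delta1_gt0 : 0 < delta1) (delta2_gt0 : 0 < delta2)
    (delta_sum : delta1 + delta2 = 1)
    (c1_gt0 : 0 < c1) (c2_gt0 : 0 < c2)
    (lam_gt0 : 0 < lam) (mu_gt0 : 0 < mu) (s_ge0 : 0 <= s)
    (tau_law : forall k, has_exponential_law lam (tau k))
    (sigma_law : forall k, has_exponential_law mu (sigma k))
    (Y0_val : forall w, Y0 w = 1 \/ Y0 w = -1)
    (Y0_neg : (0 < P [set w | (Y0 w = -1)%R])%E)
    (indep : mutually_independent (source_family Y0 tau sigma)) :
  let p1 := c1 / delta1 in
  let p2 := c2 / delta2 in
  let rho := lam / mu in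
  let gamma2 := mu - lam / p2 in
  let C2 := lam / (mu * p2) in
  let psi_ := psi tau sigma c1 c2 delta1 delta2 in
  let phi_ := phi Y0 tau sigma c1 c2 delta1 delta2 in
  let D := upper_cone delta1 delta2 in
  p2 < p1 -> rho < p1 -> rho < p2 ->
  [/\ (forall u1 u2 : R, D (u1, u2) -> (u1, u2) <> (0, 0) ->
         exists psi1 psi2 phi1 phi2 : R,
           [/\ has_partials_within D (fun x y => psi_ x y s) u1 u2 psi1 psi2,
               has_partials_within D (fun x y => phi_ x y s) u1 u2 phi1 phi2,
               c1 * psi1 + c2 * psi2
                 + (- lam - s) * psi_ u1 u2 s + lam * phi_ u1 u2 s = 0 &
               - delta1 * phi1 - delta2 * phi2
                 + mu * psi_ u1 u2 s - mu * phi_ u1 u2 s = 0]),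
      (s = 0 -> forall u1 : R, 0 <= u1 ->
         psi_ u1 (delta2 / delta1 * u1) s = C2 * expR (- gamma2 * u1 / delta1)),
      (forall u1 : R, 0 <= u1 ->
         psi_ u1 (delta2 / delta1 * u1) s =
         adjustment_coef lam mu p2 s *
           expR (- adjustment_rate lam mu p2 s * u1 / delta1)) &
      (forall u2 : R, 0 <= u2 -> phi_ 0 u2 s = 1)].
Proof.
move=> p1 p2 rho gamma2 C2 psi_ phi_ D p21 _ rho_p2.
have p20 : 0 < p2 by exact: divr_gt0.
have np : lam < mu * p2 by rewrite mulrC -ltr_pdivrMr.
pose q := p1 - p2.
have q0' : 0 < q by rewrite subr_gt0.
have q0 : q != 0 by rewrite gt_eqF.
have psiD u1 u2 : D (u1, u2) ->
    psi_ u1 u2 s = cand_psi lam mu p1 p2 s (u1 / delta1) ((u2 / delta2 - u1 / delta1) / q).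
  exact: (psiE delta1_gt0 delta2_gt0 c1_gt0 c2_gt0 lam_gt0 mu_gt0 s_ge0 tau_law sigma_law indep p21 np).
have phiD u1 u2 : D (u1, u2) ->
    phi_ u1 u2 s = cand_phi lam mu p1 p2 s (u1 / delta1) ((u2 / delta2 - u1 / delta1) / q).
  exact: (phiE delta1_gt0 delta2_gt0 c1_gt0 c2_gt0 lam_gt0 mu_gt0 s_ge0 tau_law sigma_law Y0_neg indep p21 np).
have d10 : delta1 != 0 by rewrite gt_eqF.
have d20 : delta2 != 0 by rewrite gt_eqF.
(* The form q takes as a denominator once [p1] and [p2] are unfolded for [field]. *)
have cross : c1 * delta2 + - c2 * delta1 != 0.
  rewrite (_ : _ + _ = q * (delta1 * delta2)); last by rewrite /q /p1 /p2; field; rewrite d10 d20.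
  by rewrite !mulf_neq0.
have diagonal u1 : 0 <= u1 -> psi_ u1 (delta2 / delta1 * u1) s =
    adjustment_coef lam mu p2 s * expR (- adjustment_rate lam mu p2 s * u1 / delta1).
  move=> u10; rewrite psiD; last first.
    split => //=; first by rewrite mulr_ge0 // divr_ge0 ?ltW.
    by rewrite mulrA mulrCA divff // mulr1 .
  (* On the diagonal u2 / delta2 = u1 / delta1, that is th = 0. *)
  rewrite (_ : _ / q = 0); first by rewrite cand_psi_th0 // mulrA.
  by field; rewrite q0 d10 d20.
split => //.
- move=> u1 u2 Du _.
  pose x := u1 / delta1; pose th := (u2 / delta2 - u1 / delta1) / q.
  pose px := cand_psix lam mu p1 p2 s x th.
  pose ps := cand_psi lam mu p1 p2 s x th.
  pose ph := cand_phi lam mu p1 p2 s x th.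
  pose pth := p1 * px - (lam + s) * ps + lam * ph.
  pose hx := mu * ps - mu * ph.
  pose hth := cand_phith lam mu p1 p2 s x th.
  (* The chain rule for x = u1 / delta1 and th = (u2 / delta2 - u1 / delta1) / q, with [px], [pth]
     the partials of psi and [hx], [hth] those of phi. *)
  exists (delta1^-1 * px - delta1^-1 / q * pth), (delta2^-1 / q * pth),
    (delta1^-1 * hx - delta1^-1 / q * hth), (delta2^-1 / q * hth).
  have xE : 0 + u1 * delta1^-1 = x by rewrite add0r.
  have th1E : u2 / delta2 / q + u1 * - (delta1^-1 / q) = th by rewrite /th; field; rewrite q0 d10 d20.
  have th2E : - (x / q) + u2 * (delta2^-1 / q) = th by rewrite /th /x; field; rewrite q0 d10 d20.
  have x2E : x + u2 * 0 = x by rewrite mulr0 addr0.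
  have psid := cand_psi_derive lam_gt0 mu_gt0 p20 p21 s_ge0.
  have phid := cand_phi_derive lam_gt0 mu_gt0 p20 p21 s_ge0.
  have thE1 y : (u2 / delta2 - y / delta1) / q = u2 / delta2 / q + y * - (delta1^-1 / q).
    by field; rewrite q0 d10 d20.
  have thE2 y : (y / delta2 - u1 / delta1) / q = - (x / q) + y * (delta2^-1 / q).
    by rewrite /x; field; rewrite q0 d10 d20.
  have dpsi1 := psid 0 (u2 / delta2 / q) delta1^-1 (- (delta1^-1 / q)) u1.
  have dpsi2 := psid x (- (x / q)) 0 (delta2^-1 / q) u2.
  have dphi1 := phid 0 (u2 / delta2 / q) delta1^-1 (- (delta1^-1 / q)) u1.
  have dphi2 := phid x (- (x / q)) 0 (delta2^-1 / q) u2.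
  rewrite xE th1E -/px -/ps -/ph in dpsi1.
  rewrite x2E th2E -/px -/ps -/ph in dpsi2.
  rewrite xE th1E -/ps -/ph -/hth in dphi1.
  rewrite x2E th2E -/ps -/ph -/hth in dphi2.
  split.
  - split.
    + apply: (has_derivative_within_eq (l := delta1^-1 * px - delta1^-1 / q * pth) Du _ (is_derive_eq dpsi1 _)).
        by move=> y Dy; rewrite (psiD _ _ Dy) thE1 add0r.
      by rewrite /pth; ring.
    + apply: (has_derivative_within_eq (l := delta2^-1 / q * pth) Du _ (is_derive_eq dpsi2 _)).
        by move=> y Dy; rewrite (psiD _ _ Dy) thE2 mulr0 addr0.
      by rewrite /pth; ring.
  - split.
    + apply: (has_derivative_within_eq (l := delta1^-1 * hx - delta1^-1 / q * hth) Du _ (is_derive_eq dphi1 _)).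
        by move=> y Dy; rewrite (phiD _ _ Dy) thE1 add0r.
      by rewrite /hx; ring.
    + apply: (has_derivative_within_eq (l := delta2^-1 / q * hth) Du _ (is_derive_eq dphi2 _)).
        by move=> y Dy; rewrite (phiD _ _ Dy) thE2 mulr0 addr0.
      by ring.
  (* The factor of psi_th is -(p1 - p2) / q = -1, so the transport term is p1 psi_x - psi_th. *)
  - rewrite (psiD _ _ Du) (phiD _ _ Du) -/x -/th -/ps -/ph /pth /q /p1 /p2.
    by field; rewrite d10 d20 cross.
  (* A drop leaves th unchanged: the phi_th terms cancel and the transport term is -phi_x. *)
  - rewrite (psiD _ _ Du) (phiD _ _ Du) -/x -/th -/ps -/ph /hx.
    by field; rewrite q0 d10 d20.
- move=> s0 u1 u10; rewrite (diagonal u1 u10) s0 /adjustment_coef adjustment_rate0 // -/gamma2.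
  congr (_ * _); rewrite /C2 /gamma2; field; rewrite !gt_eqF //.
- move=> u2 u20; rewrite phiD; last by split => //=; rewrite mulr0 mulr_ge0 // ltW.
  by rewrite mul0r cand_phi0.
Qed.
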